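(* Let $\mu$ be a probability measure on $\mathbb{R}^d$ with support $D$, and let $\{V_n\}_{n=0}^\infty\subset L^2_\mu(D)$ be a hierarchical sequence of finite-dimensional subspaces with $N_n=\dim V_n$ and $q^*<\infty$. For each $n$ let $\mathcal{A}_n=\{X_m\}_{m=1}^{M_n}$ with $X_m$ i.i.d. with distribution $\mu$, where $M_n=25\,q^*K_\mu(V_n)\log N_n$. If in addition $\{V_n\}_{n=0}^\infty$ is a $\mu$ZC sequence, then with probability $1$, $\{\mathcal{A}_n\}_{n=0}^\infty$ is a (classical) WAM for $\{V_n\}_{n=0}^\infty$ with exponents $a=q^*+\tau$ and $b=\frac{q^*}{2}+\tau$, for any $\tau>0$.
   Context: Functions are complex-valued and defined pointwise on $D=\operatorname{supp}\mu$. Hierarchical means $V_n\subset V_{n+1}$ and $\dim V_n<\dim V_{n+1}$, with $N_n\ge1$. For an $N$-dimensional $V\subset L^2_\mu(D)$ with $L^2_\mu$-orthonormal basis $v_1,\dots,v_N$, $K_\mu(V)=\sup_{x\in D}\sum_{i=1}^N|v_i(x)|^2$ (independent of the basis); $K_\mu(V_n)<\infty$ is assumed for all $n$. $q^*=\limsup_{n\to\infty}\frac{\log K_\mu(V_n)}{\log N_n}$. $\{V_n\}$ is a $\mu$ZC sequence if for all $n$, $\mu(\{x\in D: v(x)=0\})=0$ for every $v\in V_n\setminus\{0\}$. A sequence of finite sets $\mathcal{A}_n\subset D$ is a (classical) weakly admissible mesh (WAM) for $\{V_n\}$ with exponents $(a,b)$ if there are finite constants $k_a,k_b$ such that for all $n\ge0$: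 $\sup_{x\in D}|v(x)|\le k_bN_n^b\max_{x\in\mathcal{A}_n}|v(x)|$ for all $v\in V_n$, and $|\mathcal{A}_n|\le k_aN_n^a$. (Here $k_a$, $k_b$ may depend on $\tau$ and on the realization of the samples.)
   Formalization: The number of samples $M_n=25\,q^*K_\mu(V_n)\log N_n$ is rounded up to an integer and at least one sample is drawn, since for $N_0=1$ the formula gives $M_0=0$ and an empty mesh, for which the WAM inequality fails. *)

(* Defs.v *)
From HB Require Import structures.
From mathcomp Require Export all_boot all_order all_algebra.
From mathcomp Require Export complex finmap.
From mathcomp Require Export all_classical all_reals all_analysis.
Set Implicit Arguments.
Unset Strict Implicit.
Unset Printing Implicit Defensive.
Import Order.TTheory GRing.Theory Num.Theory.
Import numFieldNormedType.Exports.

Local Open Scope classical_set_scope.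
Local Open Scope ring_scope.

(* R^d with its Borel sigma-algebra. *)
Definition Rd (R : realType) (d : nat) :=
  g_sigma_algebraType (@open 'rV[R]_d).
HB.instance Definition _ (R : realType) (d : nat) := Measurable.on (Rd R d).

(* Topological support: the points all of whose open neighbourhoods are charged. *)
Definition supp (R : realType) (d : nat)
    (mu : {measure set (Rd R d) -> \bar R}) : set (Rd R d) :=
  [set x | forall U : set 'rV[R]_d, open U -> U x -> (0 < mu U)%E].

(* Modulus of a complex number, as an element of R (the library's norm on R[i]
   takes its values in R[i]). *)
Definition cmod (R : realType) (z : R[i]) : R :=
  Num.sqrt (complex.Re z ^+ 2 + complex.Im z ^+ 2).

(* A pointwise defined function on D = supp mu is encoded as a function on R^d
   that vanishes off D, so that equality of functions is equality on D and not
   equality mu-almost everywhere. *)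
Definition L2fun (R : realType) (d : nat) (mu : probability (Rd R d) R)
    (f : Rd R d -> R[i]) : Prop :=
  [/\ forall x, ~ supp mu x -> f x = 0,
      measurable_fun setT (fun x => complex.Re (f x)),
      measurable_fun setT (fun x => complex.Im (f x)) &
      (\int[mu]_(x in supp mu) (cmod (f x) ^+ 2)%:E < +oo)%E].

Definition L2inner (R : realType) (d : nat) (mu : probability (Rd R d) R)
    (f g : Rd R d -> R[i]) : R[i] :=
  ((\int[mu]_(x in supp mu) complex.Re (f x * (g x)^*))%R +i*
   (\int[mu]_(x in supp mu) complex.Im (f x * (g x)^*))%R)%C.

Definition is_basis (R : realType) (T : Type) (V : set (T -> R[i])) (N : nat)
    (e : 'I_N -> T -> R[i]) : Prop :=
  V = [set f | exists c : 'I_N -> R[i], f = (fun x => \sum_(i < N) c i * e i x)]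
  /\ (forall c : 'I_N -> R[i],
        (forall x, \sum_(i < N) c i * e i x = 0) -> forall i, c i = 0).

Definition subspace_of_dim (R : realType) (T : Type) (V : set (T -> R[i]))
    (N : nat) : Prop :=
  exists e : 'I_N -> T -> R[i], is_basis V e.

Definition orthonormal_basis (R : realType) (d : nat)
    (mu : probability (Rd R d) R) (V : set (Rd R d -> R[i])) (N : nat)
    (v : 'I_N -> Rd R d -> R[i]) : Prop :=
  is_basis V v /\ forall i j, L2inner mu (v i) (v j) = (i == j)%:R.

(* K_mu(V) for an N-dimensional V.  The supremum is the same for all orthonormal
   bases of V; one of them is chosen (the default value of xget is irrelevant
   as soon as V has an orthonormal basis). *)
Definition Kmu (R : realType) (d : nat) (mu : probability (Rd R d) R)
    (V : set (Rd R d -> R[i])) (N : nat) : \bar R :=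
  let v : 'I_N -> Rd R d -> R[i] :=
    xget (fun _ _ => 0) [set v | orthonormal_basis mu V v] in
  ereal_sup [set (\sum_(i < N) cmod (v i x) ^+ 2)%:E | x in supp mu].

(* The value at an n with N n = 1 is junk (division by ln 1 = 0); at most one
   such n exists when N is strictly increasing, so the limsup ignores it. *)
Definition qstar (R : realType) (d : nat) (mu : probability (Rd R d) R)
    (V : nat -> set (Rd R d -> R[i])) (N : nat -> nat) : \bar R :=
  limn_esup (fun n => (ln (fine (Kmu mu (V n) (N n))) / ln (N n)%:R)%:E).

Definition hierarchical (R : realType) (T : Type)
    (V : nat -> set (T -> R[i])) (N : nat -> nat) : Prop :=
  [/\ forall n, subspace_of_dim (V n) (N n),
      forall n, V n `<=` V n.+1,
      forall n, (N n < N n.+1)%N &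
      forall n, (1 <= N n)%N].

Definition muZC (R : realType) (d : nat) (mu : probability (Rd R d) R)
    (V : nat -> set (Rd R d -> R[i])) : Prop :=
  forall n v, V n v -> v <> (fun=> 0) ->
    mu [set x | supp mu x /\ v x = 0] = 0%E.

(* The maximum over a nonempty finite set of nonnegative reals is computed with
   base value 0; an empty mesh satisfies the bound only if v = 0 on D. *)
Definition is_WAM (R : realType) (d : nat) (D : set (Rd R d))
    (V : nat -> set (Rd R d -> R[i])) (N : nat -> nat)
    (A : nat -> {fset Rd R d}) (a b : R) : Prop :=
  (forall n x, x \in A n -> D x) /\
  exists ka kb : R, forall n,
    (forall v, V n v ->
       (ereal_sup [set (cmod (v x))%:E | x in D] <=
        (kb * ((N n)%:R `^ b) * \big[Num.max/0]_(x <- A n) cmod (v x))%:E)%E) /\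
    (#|` A n|)%:R <= ka * ((N n)%:R `^ a).

Definition mutually_independent (R : realType) (dO dT : measure_display)
    (Omega : measurableType dO) (T : measurableType dT) (P : probability Omega R)
    (I : choiceType) (X : I -> {RV P >-> T}) : Prop :=
  forall (J : {fset I}) (B : I -> set T), (forall i, measurable (B i)) ->
    P (\bigcap_(i in [set` J]) (X i @^-1` B i)) =
    (\prod_(i <- J) P (X i @^-1` B i))%E.

Definition iid (R : realType) (dO dT : measure_display)
    (Omega : measurableType dO) (T : measurableType dT) (P : probability Omega R)
    (mu : probability T R) (I : choiceType) (X : I -> {RV P >-> T}) : Prop :=
  mutually_independent X /\
  (forall i B, measurable B -> distribution P (X i) B = mu B).

(* The number 25 q* K_mu(V_n) log N_n of samples is rounded up to an integer;
   at least one sample is drawn (when N n = 1 the formula gives 0). *)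
Definition sample_size (R : realType) (d : nat) (mu : probability (Rd R d) R)
    (V : nat -> set (Rd R d -> R[i])) (N : nat -> nat) (n : nat) : nat :=
  maxn 1 `|Num.ceil (25 * fine (qstar mu V N) * fine (Kmu mu (V n) (N n)) *
                     ln (N n)%:R)|%N.

Definition sample_set (Omega : Type) (T : choiceType) (M : nat)
    (X : 'I_M -> Omega -> T) (w : Omega) : {fset T} :=
  [fset X m w | m in 'I_M]%fset.

(* Main.v *)
(* Expand functions of V_n in an L^2_mu-orthonormal basis (v_i) and write
   K = K_mu(V_n), M = M_n.  No matrix concentration inequality is needed: run the
   randomized Kaczmarz iteration x <- x - f_x(X_m) (conj v_i(X_m))_i / K on
   coefficient vectors, where f_x = sum_i x_i v_i.  Orthonormality gives
   E|x|^2 <= (1 - 1/K)^M |x_0|^2 after M independent samples, so the squared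
   Frobenius norm of the iteration matrix has mean at most
   N (1 - 1/K)^M <= N exp(-25 q^* log N), which is summable since q^* >= 1; by
   Borel-Cantelli it is eventually < 1/4, almost surely.  On the other hand the
   iteration started at u moves by at most (sum_m |f_u(X_m)|^2 / K)^(1/2), hence
   |u|^2 <= 4 M max_m |f_u(X_m)|^2 / K and sup_D |f_u| <= 2 sqrt(M) max_m |f_u(X_m)|.
   As M = O(N^(q^* + tau)), this is the WAM bound for all large n.
   For the finitely many other n, the muZC condition makes det (v_j(X_i))_{i,j<N}
   nonzero almost surely, and M >= N, so some constant works. *)
Require Import Defs.
From HB Require Import structures.
From mathcomp Require Import all_boot all_order all_algebra complex finmap.
From mathcomp Require Import all_classical all_reals all_analysis.
From mathcomp Require Import measurable_realfun ring lra spectral.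
Set Implicit Arguments.
Unset Strict Implicit.
Unset Printing Implicit Defensive.
Import Order.TTheory GRing.Theory Num.Theory.
Import numFieldNormedType.Exports.
Local Open Scope classical_set_scope.
Local Open Scope ring_scope.

(** * Independence of the next sample from the past *)

(** The joint law of [(Z, Y)] agrees on rectangles with the product of the law of [Z] and [mu],
    hence equals it; Tonelli's theorem concludes. *)
Lemma ge0_integral_indep (R : realType) (d0 d1 d2 : measure_display)
  (O : measurableType d0) (S : measurableType d1) (T : measurableType d2)
  (P : probability O R) (mu : probability T R)
  (Z : {mfun O >-> S}) (Y : {mfun O >-> T}) :
  (forall A B, measurable A -> measurable B ->
     P (Z @^-1` A `&` Y @^-1` B) = P (Z @^-1` A) * mu B)%E ->
  forall g : S * T -> \bar R, measurable_fun setT g -> (forall z, 0 <= g z)%E ->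
  (\int[P]_w g (Z w, Y w) = \int[P]_w \int[mu]_y g (Z w, y))%E.
Proof.
move=> indep g mg g0.
have mZY : measurable_fun setT (fun w => (Z w, Y w)).
  by apply: measurable_fun_pair; exact: measurable_funPT.
pose ZY : {mfun O >-> (S * T)%type} :=
  HB.pack (fun w => (Z w, Y w)) (isMeasurableFun.Build _ _ _ _ _ mZY).
have := @ge0_integral_distribution _ _ _ _ _ P ZY g mg g0.
rewrite /comp /= => <-.
have E : forall X, measurable X ->
    (distribution P Z \x mu)%E X = distribution P ZY X.
  apply: product_measure_unique => A B mA mB.
  by rewrite /= /distribution /pushforward -indep.
rewrite (eq_measure_integral (distribution P Z \x mu)%E); last first.
  by move=> A mA _; first [exact: (E A mA)|exact: (esym (E A mA))].
rewrite fubini_tonelli1// /fubini_F.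
rewrite (@ge0_integral_distribution _ _ _ _ _ P Z)//.
- exact: measurable_fun_fubini_tonelli_F.
- by move=> y; apply: integral_ge0.
Qed.

Section iid_sequence.
Context (R : realType) (d0 d1 : measure_display)
  (O : measurableType d0) (T : measurableType d1)
  (P : probability O R) (mu : probability T R).

(** Samples are indexed by [nat], although only the first [M] matter, so that iterations can recurse
    on their number. Taking some [B i] to be the whole space yields both the independence of
    subfamilies and the law of each sample. *)
Definition iid_upto (M : nat) (Y : nat -> {mfun O >-> T}) :=
  forall B : nat -> set T, (forall i, measurable (B i)) ->
    P (\bigcap_(i in `I_M) (Y i @^-1` B i)) = (\prod_(i < M) mu (B i))%E.

Definition cylinders (Y : nat -> O -> T) (m : nat) : set (set O) :=
  [set A | exists2 B : nat -> set T, forall i, measurable (B i) &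
     A = \bigcap_(i in `I_m) (Y i @^-1` B i)].

(** The sample space with the sigma-algebra generated by the samples of index below [m]; being
    determined by the past becomes measurability on this type. *)
Definition past (Y : nat -> O -> T) (m : nat) :=
  g_sigma_algebraType (cylinders Y m).

HB.instance Definition _ (Y : nat -> O -> T) (m : nat) :=
  Measurable.on (past Y m).

Lemma cylinders_measurable (Y : nat -> {mfun O >-> T}) m :
  cylinders Y m `<=` measurable.
Proof.
move=> _ [B mB ->]; apply: bigcap_measurableType => k _.
by rewrite -[_ @^-1` _]setTI; exact: (measurable_funPT (Y k)).
Qed.

Lemma past_measurable (Y : nat -> {mfun O >-> T}) m (A : set O) :
  measurable (A : set (past Y m)) -> measurable A.
Proof.
apply: smallest_sub; last exact: cylinders_measurable.
exact: sigma_algebra_measurable.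
Qed.

Lemma measurable_fun_past (Y : nat -> O -> T) m k : (k < m)%N ->
  measurable_fun setT (Y k : past Y m -> T).
Proof.
move=> km _ B mB; rewrite setTI.
apply: sub_sigma_algebra; exists (fun i => if i == k then B else setT).
  by move=> i; case: ifP.
apply/seteqP; split=> [w Bw i _ /=|w /(_ k km)/=]; last by rewrite eqxx.
by case: ifPn => // /eqP ->.
Qed.

Lemma measurable_fun_past_mono (Y : nat -> O -> T) m n d2
    (S : measurableType d2) (f : O -> S) : (m <= n)%N ->
  measurable_fun setT (f : past Y m -> S) ->
  measurable_fun setT (f : past Y n -> S).
Proof.
move=> mn mf _ B mB; have := mf measurableT B mB.
apply: sub_smallest2r => // => _ [C mC ->].
exists (fun i => if (i < m)%N then C i else setT).
  by move=> i; case: ifP.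
apply/seteqP; split=> [w Cw i/=|w Cw i/= im].
  by move=> _; case: ifP => // /Cw.
by have := Cw i (leq_trans im mn); rewrite /= im.
Qed.

Lemma measurable_fun_past_id (Y : nat -> {mfun O >-> T}) m d2
    (S : measurableType d2) (f : O -> S) :
  measurable_fun setT (f : past Y m -> S) -> measurable_fun setT f.
Proof. by move=> mf _ B mB; apply: (@past_measurable Y m); exact: mf. Qed.

(** As functions of [A] both sides are finite measures: [P] restricted to an event of sample [m],
    and a multiple of [P]. They agree on cylinders, which are stable under intersection and generate
    the past. *)
Lemma iid_upto_indep_past (M : nat) (Y : nat -> {mfun O >-> T}) m A B :
  iid_upto M Y -> (m < M)%N -> measurable (A : set (past Y m)) ->
  measurable B -> (P (A `&` Y m @^-1` B) = P A * mu B)%E.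
Proof.
move=> YP mM mA mB.
have mYB : measurable (Y m @^-1` B).
  by rewrite -[_ @^-1` _]setTI; exact: (measurable_funPT (Y m)).
pose c := (NngNum (fine_ge0 (measure_ge0 mu B))).
have cE : c%:num%:E = mu B by rewrite /= fineK// fin_num_measure.
(* A cylinder with one more constraint, on sample [m], is an event about the first [M] samples that
   leaves those after [m] free. *)
have cylE C D (mC : forall i, measurable (C i)) (mD : measurable D) :
    (P (\bigcap_(i in `I_m) (Y i @^-1` C i) `&` Y m @^-1` D)
    = (\prod_(i < m) mu (C i)) * mu D)%E.
  transitivity (\prod_(i < M) mu (if (i < m)%N then C i else
                                 if i == m :> nat then D else setT))%E.
    rewrite -(YP (fun i => if (i < m)%N then C i else
                             if i == m then D else setT)).
      congr (P _); apply/seteqP; split=> [w [Cw Dw] i /= iM|w H]; last first.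
        split.
          by move=> i /= im; have := H i (ltn_trans im mM); rewrite /= im.
        by have := H m mM; rewrite /= ltnn eqxx.
      by case: ifP => [/Cw//|]; case: ifP => // /eqP ->.
    by move=> i; do 2 case: ifP => //.
  rewrite -(big_mkord xpredT (fun i => mu (if (i < m)%N then C i else
                                 if i == m :> nat then D else setT))).
  rewrite (big_cat_nat _ (n := m)) ?(ltnW mM)//=.
  congr (_ * _)%E.
    by rewrite big_mkord; apply: eq_bigr => i _; rewrite ltn_ord.
  rewrite big_ltn// ltnn eqxx big_nat big1 ?mule1// => i /andP[mi _].
  by rewrite ltnNge (ltnW mi)/= gtn_eqF// probability_setT.
transitivity (mrestr P mYB A); first by [].
transitivity (mscale c P A); last first.
  rewrite /mscale/= cE muleC//.
apply: (@g_sigma_algebra_measure_unique _ _ _ (cylinders Y m) _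
   (fun=> setT)) => //.
- exact: cylinders_measurable.
- by move=> _; exists (fun=> setT) => //; apply/seteqP; split.
- by rewrite bigcup_const.
- move=> _ _ [C1 mC1 ->] [C2 mC2 ->].
  exists (fun i => C1 i `&` C2 i); first by move=> i; exact: measurableI.
  by apply/seteqP; split=> [w [H1 H2] i im|w H];
    [split; [exact: H1|exact: H2]|split=> i im; have [] := H i im].
- move=> _ [C mC ->]; rewrite /mrestr/= /mscale/= cE muleC.
  apply: etrans (cylE _ _ mC mB) _.
  congr (_ * _)%E; have := cylE C setT mC measurableT.
  by rewrite preimage_setT setIT probability_setT mule1.
- move=> _; apply: (@le_lt_trans _ _ (P setT)); last first.
    by rewrite probability_setT ltry.
  apply: le_measure; rewrite ?inE//; apply: measurableI => //.
Qed.

(** Conditioning on the past: a fresh sample may be integrated out against [mu]. The variable [Z] in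
    the proof is the identity, viewed as a map into [past Y m]. *)
Lemma ge0_integral_next (M : nat) (Y : nat -> {mfun O >-> T}) m
  (g : O * T -> \bar R) :
  iid_upto M Y -> (m < M)%N ->
  measurable_fun setT (g : past Y m * T -> \bar R) -> (forall z, 0 <= g z)%E ->
  (\int[P]_w g (w, Y m w) = \int[P]_w \int[mu]_y g (w, y))%E.
Proof.
move=> YP mM mg g0.
have mid : measurable_fun setT (id : O -> past Y m).
  by move=> _ B mB; rewrite setTI; exact: (@past_measurable Y m).
pose Z : {mfun O >-> past Y m} :=
  HB.pack (id : O -> past Y m) (isMeasurableFun.Build _ _ _ _ _ mid).
apply: (@ge0_integral_indep _ _ _ _ O (past Y m) T P mu Z (Y m)) => //.
by move=> A B mA mB; exact: (iid_upto_indep_past YP).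
Qed.

End iid_sequence.

(** * The Kaczmarz iteration *)

Section kaczmarz.
Context (R : realType).
Local Notation C := R[i].
Local Notation Re := complex.Re.
Local Notation Im := complex.Im.
Implicit Types (x y z : C) (a : R).

Definition sqn z : R := Re z ^+ 2 + Im z ^+ 2.

Lemma sqn_ge0 z : 0 <= sqn z.
Proof. by rewrite addr_ge0 ?sqr_ge0. Qed.

Lemma sqn_eq0 z : (sqn z == 0) = (z == 0).
Proof.
by case: z => p q; rewrite /sqn paddr_eq0 ?sqr_ge0//= !sqrf_eq0 eq_complex.
Qed.

Lemma cmod_sqr z : cmod z ^+ 2 = sqn z.
Proof. by rewrite sqr_sqrtr// sqn_ge0. Qed.

Lemma cmod_ge0 z : 0 <= cmod z. Proof. exact: sqrtr_ge0. Qed.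

Lemma ReD x y : Re (x + y) = Re x + Re y.
Proof. by case: x; case: y. Qed.

Lemma ImD x y : Im (x + y) = Im x + Im y.
Proof. by case: x; case: y. Qed.

Lemma Re_sum (I : Type) (r : seq I) (p : pred I) (F : I -> C) :
  Re (\sum_(i <- r | p i) F i) = \sum_(i <- r | p i) Re (F i).
Proof. by rewrite (big_morph _ ReD (erefl _ : Re 0 = 0)). Qed.

Lemma Im_sum (I : Type) (r : seq I) (p : pred I) (F : I -> C) :
  Im (\sum_(i <- r | p i) F i) = \sum_(i <- r | p i) Im (F i).
Proof. by rewrite (big_morph _ ImD (erefl _ : Im 0 = 0)). Qed.

Lemma conjE z : z^* = (Re z -i* Im z)%C.
Proof. by case: z. Qed.

Context (N : nat).
Implicit Types (u : 'I_N -> C).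

Definition nrm2 u : R := \sum_k sqn (u k).
(** There is no conjugation: when [v] lists the values of basis functions at a point, this is the
    value there of the function with coefficients [u]. *)
Definition pairing (v : 'I_N -> C) u : C := \sum_k v k * u k.

Lemma nrm2_ge0 u : 0 <= nrm2 u.
Proof. by apply: sumr_ge0 => k _; exact: sqn_ge0. Qed.

Lemma nrm2_sub a (d : C) (v : 'I_N -> C) u :
  nrm2 (fun k => u k - a%:C%C * d * (v k)^*) =
  nrm2 u - 2 * a * (Re d * Re (pairing v u) + Im d * Im (pairing v u))
  + a ^+ 2 * nrm2 v * sqn d.
Proof.
rewrite /nrm2 /pairing Re_sum Im_sum (mulr_sumr _ _ _ (a ^+ 2)) mulr_suml.
rewrite !(mulr_sumr _ _ _ (Re d)) !(mulr_sumr _ _ _ (Im d)) -big_split/=.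
rewrite mulr_sumr -sumrB -big_split/=; apply: eq_bigr => k _.
rewrite conjE /sqn; case: (u k) => p q; case: (v k) => r s; case: d => e f /=.
by ring.
Qed.

(** Cauchy-Schwarz: when [v] is nonzero, the residual of [u] after projection along the conjugate of
    [v] has nonnegative squared norm. *)
Lemma sqn_pairing (v : 'I_N -> C) u : sqn (pairing v u) <= nrm2 v * nrm2 u.
Proof.
have [s0|s0] := eqVneq (nrm2 v) 0.
  suff -> : pairing v u = 0.
    by rewrite /sqn/= expr0n/= addr0 mulr_ge0// nrm2_ge0.
  rewrite /pairing big1// => k _; suff /eqP -> : v k == 0 by rewrite mul0r.
  rewrite -sqn_eq0; move: s0 => /eqP; rewrite /nrm2 psumr_eq0.
    by move=> /allP/(_ k)/(_ (mem_index_enum _)).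
  by move=> *; exact: sqn_ge0.
have {}s0 : 0 < nrm2 v by rewrite lt_neqAle eq_sym s0 nrm2_ge0.
have := nrm2_ge0 (fun k => u k - (nrm2 v)^-1%:C%C * pairing v u * (v k)^*).
rewrite nrm2_sub => H.
suff : 0 <= nrm2 u - sqn (pairing v u) / nrm2 v.
  by rewrite subr_ge0 ler_pdivrMr// mulrC.
apply: le_trans H _; rewrite /sqn le_eqVlt; apply/orP; left; apply/eqP.
by field; rewrite gt_eqF.
Qed.

(** For [a] the inverse of [nrm2 v] this is the orthogonal projection onto the kernel of
    [pairing v]. A smaller [a], common to all [v], gives a relaxed step whose mean effect is easy to
    compute. *)
Definition kaczmarz_step a (v : 'I_N -> C) u : 'I_N -> C :=
  fun k => u k - a%:C%C * pairing v u * (v k)^*.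

(** The cross term gains [2 * a * sqn (pairing v u)], and the quadratic term gives back at most half
    of it. *)
Lemma nrm2_kaczmarz_step a (v : 'I_N -> C) u : 0 <= a -> a * nrm2 v <= 1 ->
  nrm2 (kaczmarz_step a v u) <= nrm2 u - a * sqn (pairing v u).
Proof.
move=> a0 av; rewrite nrm2_sub.
have : a * (a * nrm2 v) * sqn (pairing v u) <= a * sqn (pairing v u).
  by rewrite ler_wpM2r ?sqn_ge0// ler_piMr.
by rewrite /sqn; lra.
Qed.

Fixpoint kaczmarz a (v : nat -> 'I_N -> C) m u : 'I_N -> C :=
  if m is m'.+1 then kaczmarz_step a (v m') (kaczmarz a v m' u) else u.

Definition unitv (i : 'I_N) : 'I_N -> C := fun k => (i == k)%:R.

Lemma kaczmarz_linear a (v : nat -> 'I_N -> C) m u k :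
  kaczmarz a v m u k = \sum_i u i * kaczmarz a v m (unitv i) k.
Proof.
elim: m k => [|m IH] k /=.
  rewrite (bigD1 k)//= /unitv eqxx mulr1 big1 ?addr0// => i ik.
  by rewrite (negbTE ik) mulr0.
rewrite /kaczmarz_step IH; under [in RHS]eq_bigr do rewrite mulrBr.
rewrite sumrB; congr (_ - _); rewrite /pairing.
under eq_bigr do rewrite IH mulr_sumr.
rewrite exchange_big/= mulr_sumr mulr_suml; apply: eq_bigr => i _.
rewrite !mulr_sumr !mulr_suml mulr_sumr; apply: eq_bigr => l _.
by ring.
Qed.

(** The sum on the right is the squared Frobenius norm of the iteration matrix; Cauchy-Schwarz is
    applied in each coordinate. *)
Lemma nrm2_kaczmarz_le a (v : nat -> 'I_N -> C) m u :
  nrm2 (kaczmarz a v m u) <= nrm2 u * \sum_i nrm2 (kaczmarz a v m (unitv i)).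
Proof.
rewrite [X in _ <= _ * X]exchange_big mulr_sumr; apply: ler_sum => k _.
by rewrite kaczmarz_linear; exact: sqn_pairing.
Qed.

(* Moving one Kaczmarz step away from [u] costs at most the squared residual
   of [u] itself, not of the current iterate: this keeps the error additive. *)
Lemma nrm2_kaczmarz_sub a (v : nat -> 'I_N -> C) m u : 0 <= a ->
  (forall j, (j < m)%N -> a * nrm2 (v j) <= 1) ->
  nrm2 (fun k => kaczmarz a v m u k - u k) <=
  a * \sum_(j < m) sqn (pairing (v j) u).
Proof.
move=> a0; elim: m => [|m IH] av /=.
  rewrite big_ord0 mulr0 /nrm2 big1// => k _.
  by rewrite subrr /sqn/= expr0n/= addr0.
have {}IH := IH (fun j jm => av j (ltnW jm)).
rewrite big_ord_recr/= mulrDr.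
set z := fun k => kaczmarz a v m u k - u k.
set e := pairing (v m) (kaczmarz a v m u).
have -> : (fun k => kaczmarz_step a (v m) (kaczmarz a v m u) k - u k) =
          (fun k => z k - a%:C%C * e * (v m k)^*).
  by apply/funext => k; rewrite /kaczmarz_step /z addrAC.
rewrite nrm2_sub.
have ez : e = pairing (v m) z + pairing (v m) u.
  rewrite /e /pairing -big_split/=; apply: eq_bigr => k _.
  by rewrite /z -mulrDr subrK.
have : a * (a * nrm2 (v m)) * sqn e <= a * sqn e.
  by rewrite ler_wpM2r ?sqn_ge0// ler_piMr ?av.
move: IH; rewrite -/z ez; move: (pairing (v m) z) (pairing (v m) u) => [p q].
move=> [r s]; rewrite /sqn/= => IH H.
(* Let zeta and eta be the pairings of [v m] with [z] and [u]. As [e] is zeta + eta, |e|^2 - 2 Re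
   (conj e * zeta) = |eta|^2 - |zeta|^2, and the zeta term is dropped. *)
have : 0 <= a * (p ^+ 2 + q ^+ 2) by rewrite mulr_ge0// addr_ge0// sqr_ge0.
by lra.
Qed.

(** Write [u] as its image minus the displacement. The image carries at most a quarter of [nrm2 u],
    so |x + y|^2 <= 2|x|^2 + 2|y|^2 leaves half of [nrm2 u] bounded by twice the squared
    displacement. *)
Lemma kaczmarz_stability a (v : nat -> 'I_N -> C) m u : 0 <= a ->
  (forall j, (j < m)%N -> a * nrm2 (v j) <= 1) ->
  \sum_i nrm2 (kaczmarz a v m (unitv i)) < 4^-1 ->
  nrm2 u <= 4 * a * \sum_(j < m) sqn (pairing (v j) u).
Proof.
move=> a0 av small.
have H1 := nrm2_kaczmarz_sub u a0 av.
have H2 : nrm2 (kaczmarz a v m u) <= nrm2 u * 4^-1.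
  by apply: le_trans (nrm2_kaczmarz_le _ _ _ _) _; rewrite ler_wpM2l ?nrm2_ge0// ltW.
have H3 : nrm2 u <= 2 * nrm2 (kaczmarz a v m u)
                  + 2 * nrm2 (fun k => kaczmarz a v m u k - u k).
  rewrite /nrm2 !mulr_sumr -big_split/=; apply: ler_sum => k _.
  move: (kaczmarz a v m u k) (u k) => [p q] [r s]; rewrite /sqn/=.
  (* This is the identity 2p^2 + 2(p - r)^2 - r^2 = (r - 2p)^2, for both parts. *)
  have : 0 <= (r - 2 * p) ^+ 2 + (s - 2 * q) ^+ 2 by rewrite addr_ge0 ?sqr_ge0.
  by lra.
by lra.
Qed.

End kaczmarz.

(** * Measurability of complex-valued functions *)

Section cmeasurable.
Context (R : realType).
Local Notation C := R[i].
Local Notation Re := complex.Re.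
Local Notation Im := complex.Im.

Definition cmeasurable d (S : measurableType d) (f : S -> C) :=
  measurable_fun setT (fun x => Re (f x)) /\
  measurable_fun setT (fun x => Im (f x)).

Context (d : measure_display) (S : measurableType d).
Implicit Types f g : S -> C.

Lemma cmeasurable_cst (z : C) : cmeasurable (fun _ : S => z).
Proof. by split; exact: measurable_cst. Qed.

Lemma cmeasurableD f g : cmeasurable f -> cmeasurable g ->
  cmeasurable (fun x => f x + g x).
Proof.
move=> [f1 f2] [g1 g2]; split.
  by under eq_fun do rewrite ReD; exact: measurable_funD.
by under eq_fun do rewrite ImD; exact: measurable_funD.
Qed.

Lemma cmeasurableM f g : cmeasurable f -> cmeasurable g ->
  cmeasurable (fun x => f x * g x).
Proof.
move=> [f1 f2] [g1 g2]; split.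
  rewrite [X in measurable_fun _ X](_ : _ =
    fun x => Re (f x) * Re (g x) - Im (f x) * Im (g x)).
    by apply: measurable_funB; exact: measurable_funM.
  by apply/funext => x; case: (f x) => a b; case: (g x).
rewrite [X in measurable_fun _ X](_ : _ =
    fun x => Re (f x) * Im (g x) + Im (f x) * Re (g x)).
  by apply: measurable_funD; exact: measurable_funM.
by apply/funext => x; case: (f x) => a b; case: (g x).
Qed.

Lemma cmeasurable_conj f : cmeasurable f -> cmeasurable (fun x => (f x)^*).
Proof.
move=> [f1 f2]; split; first by under eq_fun do rewrite conjE/=.
by under eq_fun do rewrite conjE/=; exact: measurableT_comp.
Qed.

Lemma cmeasurable_sum (I : Type) (r : seq I) (F : I -> S -> C) :
  (forall i, cmeasurable (F i)) -> cmeasurable (fun x => \sum_(i <- r) F i x).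
Proof.
move=> mF; elim: r => [|i r IH].
  by under eq_fun do rewrite big_nil; exact: cmeasurable_cst.
by under eq_fun do rewrite big_cons; exact: cmeasurableD.
Qed.

Lemma cmeasurable_prod (I : Type) (r : seq I) (F : I -> S -> C) :
  (forall i, cmeasurable (F i)) -> cmeasurable (fun x => \prod_(i <- r) F i x).
Proof.
move=> mF; elim: r => [|i r IH].
  by under eq_fun do rewrite big_nil; exact: cmeasurable_cst.
by under eq_fun do rewrite big_cons; exact: cmeasurableM.
Qed.

Lemma cmeasurable_det k (A : 'I_k -> 'I_k -> S -> C) :
  (forall i j, cmeasurable (A i j)) ->
  cmeasurable (fun x => \det (\matrix_(i, j) A i j x)).
Proof.
move=> mA; apply: cmeasurable_sum => s; apply: cmeasurableM.
  exact: cmeasurable_cst.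
by apply: cmeasurable_prod => i; under eq_fun do rewrite mxE; exact: mA.
Qed.

Lemma measurable_sqn f : cmeasurable f ->
  measurable_fun setT (fun x => sqn (f x)).
Proof. by move=> [? ?]; apply: measurable_funD; exact: measurable_funX. Qed.

Lemma measurable_zero_set f : cmeasurable f -> measurable [set x | f x = 0].
Proof.
move=> mf; rewrite (_ : [set _ | _] = (fun x => sqn (f x)) @^-1` [set 0]).
  by rewrite -[_ @^-1` _]setTI; exact: measurable_sqn.
by apply/seteqP; split=> x /= /eqP; [rewrite -sqn_eq0|rewrite sqn_eq0] => /eqP.
Qed.

Lemma cmeasurable_comp d' (S' : measurableType d') f (h : S' -> S) :
  measurable_fun setT h -> cmeasurable f -> cmeasurable (fun x => f (h x)).
Proof.
by move=> mh [f1 f2]; split;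
  [exact: (measurableT_comp f1 mh)|exact: (measurableT_comp f2 mh)].
Qed.

Lemma measurable_nrm2 N (u : S -> 'I_N -> C) :
  (forall k, cmeasurable (u ^~ k)) ->
  measurable_fun setT (fun x => nrm2 (u x)).
Proof. by move=> mu; apply: measurable_sum => k; exact: measurable_sqn. Qed.

Lemma cmeasurable_kaczmarz_step N a (v u : S -> 'I_N -> C) :
  (forall k, cmeasurable (v ^~ k)) -> (forall k, cmeasurable (u ^~ k)) ->
  forall k, cmeasurable (fun x => kaczmarz_step a (v x) (u x) k).
Proof.
move=> mv mu k; rewrite /kaczmarz_step /pairing.
under eq_fun do rewrite -mulNr -mulrN.
apply: cmeasurableD => //; apply: cmeasurableM; last exact: cmeasurable_conj.
rewrite [X in cmeasurable X](_ : _ =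
  fun x => - a%:C%C * \sum_k v x k * u x k); last first.
  by apply/funext => x; rewrite mulrN mulNr.
apply: cmeasurableM; first exact: cmeasurable_cst.
by apply: cmeasurable_sum => i; exact: cmeasurableM.
Qed.

End cmeasurable.

(** * Contraction in mean of the random Kaczmarz iteration *)

Section random_kaczmarz.
Context (R : realType) (d0 d1 : measure_display)
  (O : measurableType d0) (T : measurableType d1)
  (P : probability O R) (mu : probability T R).
Local Notation C := R[i].
Context (M : nat) (Y : nat -> {mfun O >-> T}) (Yiid : iid_upto P mu M Y).

Section contraction.
Context (N : nat) (v : T -> 'I_N -> C) (a : R).
Hypothesis mv : forall k, cmeasurable (v ^~ k).
Hypothesis a0 : 0 <= a.
Hypothesis av : forall y, a * nrm2 (v y) <= 1.
Hypothesis tight : forall u, (\int[mu]_y (sqn (pairing (v y) u))%:E = (nrm2 u)%:E)%E.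

(** Integrate the pointwise decrease of [nrm2_kaczmarz_step]: by the Parseval identity [tight], the
    mean gain is exactly [a * nrm2 u]. *)
Lemma integral_nrm2_kaczmarz_step u :
  (\int[mu]_y (nrm2 (kaczmarz_step a (v y) u))%:E <= ((1 - a) * nrm2 u)%:E)%E.
Proof.
have m1 : measurable_fun setT (fun y => (nrm2 (kaczmarz_step a (v y) u))%:E).
  apply/measurable_EFinP/measurable_nrm2/cmeasurable_kaczmarz_step => //.
have m2 : measurable_fun setT (fun y => (sqn (pairing (v y) u))%:E).
  apply/measurable_EFinP/measurable_sqn/cmeasurable_sum => k.
  by apply: cmeasurableM => //; exact: cmeasurable_cst.
(* The subtracted term changes sides, so that only nonnegative integrands are added. *)
rewrite mulrBl mul1r EFinB leeBrDr//.
rewrite EFinM -tight -ge0_integralZl//; last first.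
  by move=> y _; rewrite lee_fin sqn_ge0.
rewrite -ge0_integralD//; last 3 first.
- by move=> y _; rewrite lee_fin nrm2_ge0.
- by move=> y _; rewrite -EFinM lee_fin mulr_ge0// sqn_ge0.
- exact: measurable_funeM.
apply: (@le_trans _ _ (\int[mu]_y (cst (nrm2 u)%:E y))%E).
  apply: ge0_le_integral => //.
  - move=> y _; rewrite -EFinM -EFinD lee_fin addr_ge0 ?nrm2_ge0//.
    by rewrite mulr_ge0// sqn_ge0.
  - by apply: emeasurable_funD => //; exact: measurable_funeM.
  - by move=> y _; rewrite /= -EFinM -EFinD lee_fin -lerBrDr nrm2_kaczmarz_step.
by rewrite tight integral_cst// [X in (_ * X)%E]probability_setT mule1.
Qed.

Let u_ u m w := kaczmarz a (fun j => v (Y j w)) m u.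

Lemma cmeasurable_kaczmarz u m k :
  cmeasurable ((fun w => u_ u m w k) : past Y m -> C).
Proof.
elim: m k => [|m IH] k; first exact: (cmeasurable_cst _ (u k)).
apply: (@cmeasurable_kaczmarz_step _ _ (past Y m.+1) _ a (fun w => v (Y m w)) (u_ u m)).
- move=> l; apply: (@cmeasurable_comp _ _ _ _ (past Y m.+1) (v ^~ l) (Y m)) => //.
  exact: measurable_fun_past.
- move=> l; have [r i] := IH l.
  by split; [apply: measurable_fun_past_mono r|apply: measurable_fun_past_mono i].
Qed.

(** The iterate after [m] steps depends only on the past and sample [m] is fresh, so conditioning
    reduces each step to the one-step contraction. *)
Lemma integral_nrm2_kaczmarz u m : (m <= M)%N -> a <= 1 ->
  (\int[P]_w (nrm2 (kaczmarz a (fun j => v (Y j w)) m u))%:E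
     <= ((1 - a) ^+ m * nrm2 u)%:E)%E.
Proof.
move=> + a1; elim: m => [|m IH] mM.
  rewrite -[leLHS]/(\int[P]_w cst (nrm2 u)%:E w)%E.
  by rewrite expr0 mul1r integral_cst// [X in (_ * X)%E]probability_setT mule1.
rewrite /=.
pose g z := (nrm2 (kaczmarz_step a (v z.2) (u_ u m z.1)))%:E.
have g0 z : (0 <= g z)%E by rewrite lee_fin nrm2_ge0.
have mg : measurable_fun setT (g : past Y m * T -> \bar R).
  apply/measurable_EFinP/measurable_nrm2/cmeasurable_kaczmarz_step => k.
    by apply: (cmeasurable_comp _ (mv k)); exact: measurable_snd.
  apply: (@cmeasurable_comp _ _ (past Y m) _ _ (fun w => u_ u m w k) fst).
    exact: measurable_fst.
  exact: cmeasurable_kaczmarz.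
rewrite (ge0_integral_next Yiid mM mg g0).
have mu_ : measurable_fun setT (fun w => (nrm2 (u_ u m w))%:E).
  apply/measurable_EFinP/measurable_nrm2 => k.
  have [r i] := cmeasurable_kaczmarz u m k.
  by split; apply: measurable_fun_past_id; [exact: r|exact: i].
apply: (@le_trans _ _ (\int[P]_w ((1 - a)%:E * (nrm2 (u_ u m w))%:E))%E).
  apply: ge0_le_integral => //=.
  - by move=> w _; apply: integral_ge0 => y _; rewrite lee_fin nrm2_ge0.
  - apply: (@measurable_fun_past_id _ _ _ _ Y m).
    exact: (@measurable_fun_fubini_tonelli_F _ _ (past Y m) T R mu g mg g0).
  - exact: measurable_funeM.
  - move=> w _; rewrite -EFinM /g /=; exact: (integral_nrm2_kaczmarz_step (u_ u m w)).
rewrite ge0_integralZl//; last 2 first.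
- by move=> w _; rewrite lee_fin nrm2_ge0.
- by rewrite lee_fin subr_ge0.
rewrite exprS -mulrA EFinM; apply: lee_wpmul2l.
  by rewrite lee_fin subr_ge0.
exact: (IH (ltnW mM)).
Qed.

End contraction.
End random_kaczmarz.

(** * Generic nonvanishing of the sample determinant *)

Section generic_determinant.
Context (R : realType) (d0 d1 : measure_display)
  (O : measurableType d0) (T : measurableType d1)
  (P : probability O R) (mu : probability T R).
Local Notation C := R[i].
Context (M : nat) (Y : nat -> {mfun O >-> T}) (Yiid : iid_upto P mu M Y).
Context (v : nat -> T -> C).
Hypothesis mv : forall k, cmeasurable (v k).

Definition sample_mx k (w : O) : 'M[C]_k := \matrix_(i, j) v j (Y i w).

(** Rows and columns are selected by arbitrary [f] and [g], to cover the sample matrix as well as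
    its minors. *)
Lemma cmeasurable_det_past m k (f : 'I_k -> nat) (g : 'I_k -> nat) :
  (forall i, (f i < m)%N) ->
  cmeasurable ((fun w => \det (\matrix_(i < k, j < k) v (g j) (Y (f i) w)))
    : past Y m -> C).
Proof.
move=> fm; apply: (@cmeasurable_det _ _ (past Y m) k
  (fun i j w => v (g j) (Y (f i) w))) => i j.
apply: (@cmeasurable_comp _ _ _ _ (past Y m) (v (g j)) (Y (f i))) => //.
exact: measurable_fun_past.
Qed.

(* Laplace expansion along the last sample: the coefficient of [v k] is the
   previous determinant, so the expansion is a nonzero combination of the [v j]. *)
Lemma sample_mx_singular_negligible n : (n <= M)%N ->
  (forall k (c : 'I_k.+1 -> C), (k < n)%N -> c ord_max != 0 ->
     mu [set y | \sum_(j < k.+1) c j * v j y = 0] = 0%E) ->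
  P [set w | \det (sample_mx n w) = 0] = 0%E.
Proof.
elim: n => [|k IH] nM vZ.
  rewrite (_ : [set _ | _] = set0) ?measure0//.
  by apply/seteqP; split=> w //=; rewrite det_mx00 => /eqP; rewrite oner_eq0.
have {}IH := IH (ltnW nM) (fun l c lk => vZ l c (ltnW lk)).
pose cof (j : 'I_k.+1) w := (-1) ^+ (k + j) *
  \det (\matrix_(i < k, l < k) v (lift j l) (Y i w)).
have mcof j : cmeasurable (cof j : past Y k -> C).
  apply: cmeasurableM; first exact: cmeasurable_cst.
  exact: (cmeasurable_det_past (fun l => lift j l) (fun i : 'I_k => ltn_ord i)).
have cofE w : cof ord_max w = \det (sample_mx k w).
  rewrite /cof -signr_odd addnn odd_double mul1r; congr (\det _).
  by apply/matrixP => i j; rewrite !mxE lift_max.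
have detE w : \det (sample_mx k.+1 w) = \sum_j cof j w * v j (Y k w).
  rewrite (expand_det_row _ ord_max); apply: eq_bigr => j _.
  rewrite mulrC mxE; congr (_ * _); rewrite /cofactor /cof; congr (_ * \det _).
  by apply/matrixP => i l; rewrite !mxE lift_max.
(* The event that the previous determinant is nonzero while the next one vanishes, as a set of pairs
   (past, fresh sample). Each section at a fixed past is null by [vZ]. *)
pose E := [set z : past Y k * T | cof ord_max z.1 != 0 /\
             \sum_j cof j z.1 * v j z.2 = 0].
have mE : measurable E.
  rewrite (_ : E = ~` [set z | cof ord_max z.1 = 0] `&`
    [set z | \sum_j cof j z.1 * v j z.2 = 0]); last first.
    by apply/seteqP; split=> z [/= /eqP].
  apply: measurableI.
    apply/measurableC/measurable_zero_set.
    exact: (cmeasurable_comp measurable_fst (mcof ord_max)).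
  apply: measurable_zero_set; apply: cmeasurable_sum => j; apply: cmeasurableM.
    exact: (cmeasurable_comp measurable_fst (mcof j)).
  exact: (cmeasurable_comp measurable_snd (mv j)).
have mdet n : measurable [set w | \det (sample_mx n w) = 0].
  apply: (@past_measurable _ _ _ _ Y n); apply: measurable_zero_set.
  exact: (cmeasurable_det_past val (fun i : 'I_n => ltn_ord i)).
have mF : measurable [set w | E (w, Y k w)].
  rewrite (_ : [set w | _] = ~` [set w | \det (sample_mx k w) = 0] `&`
      [set w | \det (sample_mx k.+1 w) = 0]).
    by apply: measurableI => //; exact: measurableC.
  apply/seteqP; split=> w; rewrite /E /= cofE detE.
    by move=> [/eqP].
  by move=> [/eqP].
have PE : P [set w | E (w, Y k w)] = 0%E.
  have -> : P [set w | E (w, Y k w)] = (\int[P]_w (\1_E (w, Y k w))%:E)%E.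
    by have := integral_indic P measurableT mF; rewrite setIT => <-.
  have mE1 : measurable_fun setT
      ((fun z => (\1_E z)%:E) : past Y k * T -> \bar R).
    by apply/measurable_EFinP; exact: measurable_indic.
  rewrite (ge0_integral_next Yiid nM mE1)//.
  rewrite (eq_integral (cst 0%E)) ?integral0// => w _.
  have [c0|c0] := eqVneq (cof ord_max w) 0.
    rewrite (eq_integral (cst 0%E)) ?integral0// => y _.
    by rewrite indicE memNset//= => -[/eqP].
  have mEw : measurable [set y | E (w, y)].
    have := measurable_xsection (w : past Y k) mE; congr (measurable _).
    by apply/seteqP; split=> y; rewrite /xsection /= inE.
  rewrite -[LHS]/(\int[mu]_y (\1_[set y | E (w, y)] y)%:E)%E.
  rewrite integral_indic// setIT -[RHS](vZ k (cof ^~ w) (ltnSn k) c0).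
  by congr (mu _); apply/seteqP; split=> y; [case|].
(* If the larger matrix is singular, either the smaller one already is, which is negligible by
   induction, or [E] occurs. *)
apply: measure_negligible => //.
have N1 : P.-negligible [set w | \det (sample_mx k w) = 0] by exact/negligibleP.
have N2 : P.-negligible [set w | E (w, Y k w)] by exact/negligibleP.
apply: negligibleS (negligibleU N1 N2) => w /= dw.
have [dk|dk] := eqVneq (\det (sample_mx k w)) 0; [by left|right].
by rewrite /E/= cofE -detE.
Qed.

End generic_determinant.

(** * The support and the L2 inner product *)

Section support.
Context (R : realType) (d : nat) (mu : probability (Rd R d) R).

Lemma open_measurable_Rd (U : set 'rV[R]_d) :
  open U -> measurable (U : set (Rd R d)).
Proof. by move=> oU; exact: sub_sigma_algebra. Qed.

(** Rational balls form a countable base, which turns the complement of the support into a countable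
    union of null sets. *)
Let rat_ball (p : 'rV[rat]_d * rat) : set 'rV[R]_d :=
  if 0 < p.2 then ball (map_mx (ratr : rat -> R) p.1) (ratr p.2) else set0.

Let open_rat_ball p : open (rat_ball p).
Proof.
rewrite /rat_ball; case: ifPn => [r0|_]; last exact: open0.
by apply: ball_open; rewrite ltr0q.
Qed.

Let rat_ball_sub (U : set 'rV[R]_d) x : open U -> U x ->
  exists p, rat_ball p x /\ rat_ball p `<=` U.
Proof.
move=> oU Ux; have := open_nbhs_nbhs (conj oU Ux).
move=> /nbhs_ballP[_/posnumP[e] eU].
have e20 : 0 < e%:num / 2 by [].
have [r /andP[r0 re]] : exists r : rat, 0 < (ratr r : R) < e%:num / 2.
  have [r] := rat_in_itvoo e20; rewrite in_itv/= => H.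
  by exists r.
have /choice[q qx] : forall i : 'I_d, exists q : rat,
    `|x 0 i - ratr q| < ratr r.
  move=> i; have : x 0 i - ratr r < x 0 i + ratr r by lra.
  move=> /rat_in_itvoo[q]; rewrite in_itv/= => /andP[H1 H2].
  by exists q; rewrite ltr_norml; apply/andP; split; lra.
have xb : ball (map_mx (ratr : rat -> R) (\row_i q i)) (ratr r) x.
  split=> // i j; rewrite !mxE ord1 /ball /= distrC.
  exact: qx.
have r0' : 0 < r by rewrite -(ltr0q R).
exists (\row_i q i, r); rewrite /rat_ball/= r0'; split => // y yb.
apply: eU; rewrite (_ : e%:num = e%:num / 2 + e%:num / 2); last by rewrite -splitr.
apply: ball_triangle (ball_sym (le_ball (ltW re) xb)) (le_ball (ltW re) yb).
Qed.

Lemma setC_suppE : ~` supp mu =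
  \bigcup_(p in [set p | mu (rat_ball p) = 0%E]) rat_ball p.
Proof.
apply/seteqP; split=> [x|x [p p0 px] xs].
  move=> /existsNP[U] /not_implyP[oU] /not_implyP[Ux] /negP; rewrite -leNgt => U0.
  have [p [px pU]] := rat_ball_sub oU Ux; exists p => //=.
  apply/eqP; rewrite eq_le measure_ge0 andbT (le_trans _ U0)//.
  by apply: le_measure; rewrite ?inE//; exact: open_measurable_Rd.
by have /gt_eqF/negP := xs _ (@open_rat_ball p) px; apply; exact/eqP.
Qed.

Lemma measurable_supp : measurable (supp mu).
Proof.
rewrite -[supp mu]setCK setC_suppE; apply: measurableC.
by apply: open_measurable_Rd; apply: bigcup_open => p _; exact: open_rat_ball.
Qed.

(** The sequence [F] enumerates the null rational balls by decoding integers, with the empty set at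
    all other indices; a countable union of null sets is null. *)
Lemma measure_setC_supp : mu (~` supp mu) = 0%E.
Proof.
rewrite setC_suppE; apply: measure_negligible.
  by apply: open_measurable_Rd; apply: bigcup_open => p _; exact: open_rat_ball.
pose F n := if @choice.unpickle ('rV[rat]_d * rat)%type n is Some p then
  (if pselect (mu (rat_ball p) = 0%E) then rat_ball p else set0) else set0.
have F0 : mu.-negligible (\bigcup_n F n).
  apply: negligible_bigcup => n; rewrite /F.
  case: choice.unpickle => [p|]; last exact: negligible_set0.
  case: (pselect (mu (rat_ball p) = 0%E)) => [p0|p0]; last exact: negligible_set0.
  apply/negligibleP => //; apply: open_measurable_Rd; exact: open_rat_ball.
apply: negligibleS F0 => x [p p0 px]; exists (choice.pickle p) => //.
by rewrite /F choice.pickleK; case: (pselect (mu (rat_ball p) = 0%E)).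
Qed.

Lemma measure_supp : mu (supp mu) = 1%E.
Proof.
rewrite -[supp mu]setCK probability_setC ?measure_setC_supp ?sube0//.
exact: measurableC measurable_supp.
Qed.

End support.

Section L2.
Context (R : realType) (d : nat) (mu : probability (Rd R d) R).
Local Notation C := R[i].
Local Notation Re := complex.Re.
Local Notation Im := complex.Im.
Local Notation D := (supp mu).
Local Notation T := (Rd R d).
Implicit Types (f g h : T -> C).

Definition cintegrable h :=
  mu.-integrable D (EFin \o (fun x => Re (h x))) /\
  mu.-integrable D (EFin \o (fun x => Im (h x))).

Definition cintegral h : C :=
  ((\int[mu]_(x in D) Re (h x))%R +i* (\int[mu]_(x in D) Im (h x))%R)%C.

Let mD : measurable D := measurable_supp mu.

Lemma cintegrable0 : cintegrable (fun=> 0).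
Proof. by split; exact: integrable0. Qed.

Lemma cintegrableD f g : cintegrable f -> cintegrable g ->
  cintegrable (fun x => f x + g x).
Proof.
move=> [f1 f2] [g1 g2]; split.
  by apply: eq_integrable (integrableD mD f1 g1) => // x _; rewrite /= ReD.
by apply: eq_integrable (integrableD mD f2 g2) => // x _; rewrite /= ImD.
Qed.

Lemma cintegralD f g : cintegrable f -> cintegrable g ->
  cintegral (fun x => f x + g x) = cintegral f + cintegral g.
Proof.
move=> [f1 f2] [g1 g2]; rewrite /cintegral.
under eq_Rintegral do rewrite ReD.
under [X in (_ +i* X)%C]eq_Rintegral do rewrite ImD.
by rewrite !RintegralD.
Qed.

Lemma cintegrableZ (c : C) f : cintegrable f -> cintegrable (fun x => c * f x).
Proof.
move=> [f1 f2]; case: c => a b; split.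
  apply: eq_integrable
    (integrableB mD (integrableZl mD a f1) (integrableZl mD b f2)) => //.
  by move=> x _ /=; case: (f x).
apply: eq_integrable
  (integrableD mD (integrableZl mD a f2) (integrableZl mD b f1)) => //.
by move=> x _ /=; case: (f x).
Qed.

Lemma cintegralZ (c : C) f : cintegrable f ->
  cintegral (fun x => c * f x) = c * cintegral f.
Proof.
move=> [f1 f2]; case: c => a b; rewrite /cintegral.
have E1 : forall x, x \in D -> Re ((a +i* b)%C * f x) = a * Re (f x) - b * Im (f x).
  by move=> x _; case: (f x).
have E2 : forall x, x \in D -> Im ((a +i* b)%C * f x) = a * Im (f x) + b * Re (f x).
  by move=> x _; case: (f x).
have Z r (k : T -> R) : mu.-integrable D (EFin \o k) ->
    mu.-integrable D (EFin \o (fun x => r * k x)).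
  by move=> kk; apply: eq_integrable (integrableZl mD r kk).
rewrite (eq_Rintegral _ E1) (eq_Rintegral _ E2).
rewrite RintegralB// ?RintegralD//; try exact: Z.
by rewrite !RintegralZl.
Qed.

Lemma cintegrable_sum (I : Type) (r : seq I) (h : I -> T -> C) :
  (forall i, cintegrable (h i)) -> cintegrable (fun x => \sum_(i <- r) h i x).
Proof.
move=> hh; elim: r => [|i r IH].
  by under eq_fun do rewrite big_nil; exact: cintegrable0.
by under eq_fun do rewrite big_cons; exact: cintegrableD.
Qed.

Lemma cintegral_sum (I : Type) (r : seq I) (h : I -> T -> C) :
  (forall i, cintegrable (h i)) ->
  cintegral (fun x => \sum_(i <- r) h i x) = \sum_(i <- r) cintegral (h i).
Proof.
move=> hh; elim: r => [|i r IH].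
  under eq_fun do rewrite big_nil.
  by rewrite big_nil /cintegral/= /Rintegral integral0.
rewrite big_cons -IH -cintegralD//; last exact: cintegrable_sum.
by under eq_fun do rewrite big_cons.
Qed.

Lemma L2fun_cmeasurable f : L2fun mu f -> cmeasurable f.
Proof. by case. Qed.

Lemma L2fun_integrable_sqn f : L2fun mu f ->
  mu.-integrable D (EFin \o (fun x => sqn (f x))).
Proof.
move=> Lf; have [_ _ _ foo] := Lf; apply/integrableP; split.
  apply: measurable_funTS; apply/measurable_EFinP.
  exact/measurable_sqn/L2fun_cmeasurable.
apply: le_lt_trans foo; rewrite le_eqVlt; apply/orP; left; apply/eqP.
by apply: eq_integral => x _ /=; rewrite ger0_norm ?sqn_ge0// cmod_sqr.
Qed.

(** Both parts are dominated by |f|^2 + |g|^2; the squares of sums and differences fed to [nra]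
    bound each product. *)
Lemma L2inner_cintegrable f g : L2fun mu f -> L2fun mu g ->
  cintegrable (fun x => f x * (g x)^*).
Proof.
move=> Lf Lg.
have [m1 m2] := cmeasurableM (L2fun_cmeasurable Lf)
                  (cmeasurable_conj (L2fun_cmeasurable Lg)).
have H := integrableD mD (L2fun_integrable_sqn Lf) (L2fun_integrable_sqn Lg).
split.
- apply: le_integrable H => //.
    by apply: measurable_funTS; exact/measurable_EFinP.
  move=> x _; rewrite /= lee_fin conjE /sqn.
  rewrite [leRHS]ger0_norm; last by rewrite addr_ge0// addr_ge0// sqr_ge0.
  case: (f x) => a b; case: (g x) => p q /=; rewrite ler_norml.
  have := sqr_ge0 (a - p); have := sqr_ge0 (a + p).
  have := sqr_ge0 (b - q); have := sqr_ge0 (b + q).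
  by move=> *; apply/andP; split; nra.
- apply: le_integrable H => //.
    by apply: measurable_funTS; exact/measurable_EFinP.
  move=> x _; rewrite /= lee_fin conjE /sqn.
  rewrite [leRHS]ger0_norm; last by rewrite addr_ge0// addr_ge0// sqr_ge0.
  case: (f x) => a b; case: (g x) => p q /=; rewrite ler_norml.
  have := sqr_ge0 (a - q); have := sqr_ge0 (a + q).
  have := sqr_ge0 (b - p); have := sqr_ge0 (b + p).
  by move=> *; apply/andP; split; nra.
Qed.

Lemma L2innerE f g : L2inner mu f g = cintegral (fun x => f x * (g x)^*).
Proof. by []. Qed.

Lemma L2inner_lincomb N (e : 'I_N -> T -> C) (x y : 'I_N -> C) :
  (forall i, L2fun mu (e i)) ->
  L2inner mu (fun t => \sum_i x i * e i t) (fun t => \sum_j y j * e j t) =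
  \sum_i \sum_j x i * L2inner mu (e i) (e j) * (y j)^*.
Proof.
move=> Le; rewrite L2innerE.
have ie i j : cintegrable (fun t => x i * (y j)^* * (e i t * (e j t)^*)).
  exact/cintegrableZ/L2inner_cintegrable.
rewrite (_ : (fun _ => _) =
    fun t => \sum_i \sum_j x i * (y j)^* * (e i t * (e j t)^*)).
  rewrite cintegral_sum; last by move=> i; exact: cintegrable_sum.
  apply: eq_bigr => i _; rewrite cintegral_sum//; apply: eq_bigr => j _.
  rewrite cintegralZ; last exact: L2inner_cintegrable.
  by rewrite -L2innerE; ring.
apply/funext => t; rewrite rmorph_sum mulr_suml; apply: eq_bigr => i _.
rewrite mulr_sumr; apply: eq_bigr => j _; rewrite rmorphM/=; ring.
Qed.

Lemma L2innerC f g : L2fun mu f -> L2fun mu g ->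
  L2inner mu g f = (L2inner mu f g)^*.
Proof.
move=> Lf Lg; rewrite conjE /L2inner /=; apply/eqP; rewrite eq_complex /=.
apply/andP; split; apply/eqP.
  by apply: eq_Rintegral => x _; rewrite !conjE;
    case: (f x); case: (g x) => *; rewrite /=; ring.
rewrite -[RHS]mulN1r -RintegralZl//; last by have [] := L2inner_cintegrable Lf Lg.
by apply: eq_Rintegral => x _; rewrite !conjE;
    case: (f x); case: (g x) => *; rewrite /=; ring.
Qed.

Lemma L2inner_self f : L2inner mu f f = (\int[mu]_(x in D) sqn (f x))%:C%C.
Proof.
rewrite /L2inner; apply/eqP; rewrite eq_complex /=; apply/andP; split; apply/eqP.
  apply: eq_Rintegral => x _; rewrite conjE /sqn; case: (f x) => a b /=; ring.
transitivity (\int[mu]_(x in D) (0 : R))%R.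
  by apply: eq_Rintegral => x _; rewrite conjE; case: (f x) => a b /=; ring.
by rewrite /Rintegral integral0.
Qed.

(** Were the integral zero, [f] would vanish almost everywhere on the support, and two null sets
    would cover a set of measure 1. *)
Lemma L2norm_gt0 f : L2fun mu f -> mu [set x | D x /\ f x = 0] = 0%E ->
  0 < \int[mu]_(x in D) sqn (f x).
Proof.
move=> Lf f0; rewrite lt_neqAle Rintegral_ge0 ?andbT; last first.
  by move=> x _; exact: sqn_ge0.
apply/negP => /eqP/esym I0.
have If := L2fun_integrable_sqn Lf.
have I1 : (\int[mu]_(x in D) `|(sqn (f x))%:E| = 0)%E.
  transitivity (\int[mu]_(x in D) (sqn (f x))%:E)%E.
    by apply: eq_integral => x _; rewrite gee0_abs// lee_fin sqn_ge0.
  by rewrite -[LHS]fineK ?integrable_fin_num//; congr EFin.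
have /integrableP[mf _] := If.
have /(ae_eq_integral_abs mu mD mf) [A [mA A0 NA]] := I1.
have : (mu D <= mu (A `|` [set x | D x /\ f x = 0%R]))%E.
  apply: le_measure; rewrite ?inE//.
    apply: measurableU => //; apply: measurableI => //.
    exact/measurable_zero_set/L2fun_cmeasurable.
  move=> x Dx; have [fx|fx] := eqVneq (f x) 0; [by right|left].
  apply: NA => /= /(_ Dx) [/eqP]; rewrite sqn_eq0; exact/negP.
rewrite measure_supp measureU0//; last first.
  apply: measurableI => //; exact/measurable_zero_set/L2fun_cmeasurable.
by rewrite A0 lee_fin ler10.
Qed.

End L2.

(** * Existence of orthonormal bases *)

Section orthonormal.
Local Open Scope sesquilinear_scope.
Context (R : realType) (d : nat) (mu : probability (Rd R d) R).
Local Notation C := R[i].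
Local Notation T := (Rd R d).

Lemma is_basis_unitmx (V : set (T -> C)) N (e : 'I_N -> T -> C) (S : 'M[C]_N) :
  is_basis V e -> S \in unitmx ->
  is_basis V (fun i x => \sum_k S i k * e k x).
Proof.
move=> [VE free] uS.
have swap (c : 'I_N -> C) x : \sum_i c i * (\sum_k S i k * e k x) =
    \sum_k (\row_i c i *m S) 0 k * e k x.
  under eq_bigr do rewrite mulr_sumr.
  rewrite exchange_big; apply: eq_bigr => k _.
  by rewrite mxE mulr_suml; apply: eq_bigr => i _; rewrite mxE mulrA.
split.
  rewrite VE; apply/seteqP; split=> f [c ->].
    exists (fun i => (\row_k c k *m invmx S) 0 i).
    apply/funext => x; rewrite swap.
    rewrite (_ : \row_i _ = \row_k c k *m invmx S); last first.
      by apply/rowP => i; rewrite mxE.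
    by rewrite mulmxKV//; apply: eq_bigr => k _; rewrite mxE.
  exists (fun k => (\row_i c i *m S) 0 k); apply/funext => x; exact: swap.
move=> c c0 i.
have /free H : forall x, \sum_k (\row_i c i *m S) 0 k * e k x = 0.
  by move=> x; rewrite -swap.
have : \row_i c i *m S = 0 by apply/rowP => k; rewrite [LHS]H mxE.
move=> /(congr1 (mulmx^~ (invmx S))); rewrite mulmxK// mul0mx.
by move=> /rowP/(_ i); rewrite !mxE.
Qed.

Lemma is_basis_lincomb (V : set (T -> C)) N (e : 'I_N -> T -> C) (c : 'I_N -> C) :
  is_basis V e -> V (fun x => \sum_i c i * e i x).
Proof. by move=> [-> _]; exists c. Qed.

Lemma is_basis_mem (V : set (T -> C)) N (e : 'I_N -> T -> C) i :
  is_basis V e -> V (e i).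
Proof.
move=> bV; have := is_basis_lincomb (unitv _ i) bV; congr (V _).
apply/funext => x; rewrite (bigD1 i)//= /unitv eqxx mul1r big1 ?addr0// => j ji.
by rewrite eq_sym (negbTE ji) mul0r.
Qed.

(** The Gram matrix [H] of any basis is Hermitian, so a unitary change of basis diagonalizes it. The
    eigenvalues are the squared norms of the new functions, positive by the zero-set hypothesis, and
    rescaling by their square roots finishes. *)
Lemma orthonormal_basis_exists (V : set (T -> C)) N :
  (forall f, V f -> L2fun mu f) ->
  (forall v, V v -> v <> (fun=> 0) ->
     mu [set x | supp mu x /\ v x = 0] = 0%E) ->
  subspace_of_dim V N -> exists v : 'I_N -> T -> C, orthonormal_basis mu V v.
Proof.
move=> VL VZ [e be]; have Le i : L2fun mu (e i) by apply: VL; exact: is_basis_mem be.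
pose H : 'M[C]_N := \matrix_(i, j) L2inner mu (e i) (e j).
have Hherm : H ^t* = H.
  by apply/matrixP => i j; rewrite !mxE -(L2innerC (Le j) (Le i)).
have /orthomx_spectralP : H \is normalmx by apply/normalmxP; rewrite Hherm.
set U := spectralmx H; set s := spectral_diag H => HE.
have uU : U \is unitarymx by exact: spectral_unitarymx.
have UHU : U *m H *m U ^t* = diag_mx s.
  rewrite HE -(invmx_unitary uU) !mulmxA mulmxV ?spectral_unit// mul1mx.
  by rewrite mulmxK// spectral_unit.
have inner (A B : 'M[C]_N) i j : L2inner mu
    (fun x => \sum_k A i k * e k x) (fun x => \sum_k B j k * e k x) =
    (A *m H *m B ^t*) i j.
  rewrite L2inner_lincomb// mxE exchange_big; apply: eq_bigr => l _.
  by rewrite mxE mulr_suml; apply: eq_bigr => k _; rewrite !mxE.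
pose n i := (\int[mu]_(x in supp mu) sqn (\sum_k U i k * e k x))%R.
have bU := is_basis_unitmx be (spectral_unit H).
have sE i : s 0 i = (n i)%:C%C.
  by rewrite -[RHS]L2inner_self inner UHU mxE eqxx.
have n_gt0 i : 0 < n i.
  apply: L2norm_gt0; first by apply: VL; exact: is_basis_lincomb be.
  apply: VZ; first exact: is_basis_lincomb be.
  (* A vanishing combination would make row [i] of the unitary matrix [U] zero. *)
  move=> U0.
  have [_ /(_ (U i)) Ui0] := be.
  have : row i U = 0.
    apply/rowP => k; rewrite !mxE; apply: Ui0 => x.
    exact: (congr1 (fun f : T -> C => f x) U0).
  move=> Ur0; have : row i (U *m U ^t*) = 0 by rewrite row_mul Ur0 mul0mx.
  rewrite (unitarymxP uU) => /rowP/(_ i); rewrite !mxE eqxx => /eqP.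
  by rewrite oner_eq0.
pose t i : C := (Num.sqrt (n i))^-1%:C%C.
pose S := diag_mx (\row_i t i) *m U.
exists (fun i x => \sum_k S i k * e k x); split.
  apply: is_basis_unitmx => //; rewrite unitmx_mul spectral_unit andbT.
  rewrite unitmxE det_diag unitfE; apply/prodf_neq0 => i _.
  by rewrite mxE /t eq_complex/= negb_and invr_eq0 sqrtr_eq0 -ltNge n_gt0.
move=> i j; rewrite inner.
have -> : S *m H *m S ^t* = diag_mx (\row_i t i) *m diag_mx s *m
    diag_mx (\row_i t i).
  rewrite -UHU /S trmx_mul map_mxM tr_diag_mx map_diag_mx !mulmxA.
  congr (_ *m diag_mx _); apply/rowP => k; rewrite !mxE /t.
  by rewrite -[LHS]/(((Num.sqrt (n k))^-1)%:C%C^*) conjE/= oppr0.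
rewrite !mulmx_diag mxE !mxE sE /t.
case: eqVneq => [->|]; rewrite ?mulr1n ?mulr0n//.
rewrite -!rmorphM/= -[RHS](rmorph1 (real_complex R)); congr (_%:C)%C.
have := n_gt0 j => nj; rewrite -[X in _ * X * _]sqr_sqrtr ?ltW//.
by field; rewrite gt_eqF// sqrtr_gt0.
Qed.

End orthonormal.

(** * Parseval's identity and the constant [Kmu] *)

Section Christoffel.
Context (R : realType) (d : nat) (mu : probability (Rd R d) R).
Local Notation C := R[i].
Local Notation T := (Rd R d).

(** Functions of [V] vanish off the support, so the integral over the whole space is the inner
    product of a function with itself, expanded in the basis. *)
Lemma orthonormal_basis_tight (V : set (T -> C)) N (v : 'I_N -> T -> C) u :
  (forall f, V f -> L2fun mu f) -> orthonormal_basis mu V v ->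
  (\int[mu]_y (sqn (pairing (v ^~ y) u))%:E = (nrm2 u)%:E)%E.
Proof.
move=> VL [bv ov].
have Lv i : L2fun mu (v i) by apply: VL; exact: is_basis_mem bv.
pose f y := \sum_i u i * v i y.
have fE y : pairing (v ^~ y) u = f y.
  by apply: eq_bigr => i _; rewrite mulrC.
have Lf : L2fun mu f by apply: VL; exact: is_basis_lincomb bv.
under eq_integral do rewrite fE.
have -> : (\int[mu]_y (sqn (f y))%:E = \int[mu]_(y in supp mu) (sqn (f y))%:E)%E.
  rewrite [RHS]integral_mkcond; apply: eq_integral => y _; rewrite patchE.
  case: ifPn => // /negP ys; have [f0 _ _ _] := Lf.
  rewrite f0 ?/sqn/= ?expr0n/= ?addr0//.
  by move=> ys'; apply: ys; rewrite inE.
rewrite -[LHS]fineK; last first.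
  apply: integrable_fin_num; first exact: measurable_supp.
  exact: L2fun_integrable_sqn.
congr EFin; rewrite -[LHS]/(\int[mu]_(y in supp mu) sqn (f y))%R.
have := L2inner_self mu f; rewrite L2inner_lincomb// => /(congr1 (@complex.Re R)).
rewrite /= => <-; rewrite Re_sum /nrm2; apply: eq_bigr => i _.
rewrite (bigD1 i)//= ov eqxx mulr1 ReD big1 ?addr0; last first.
  by move=> j ji; rewrite ov eq_sym (negbTE ji) mulr0 mul0r.
by rewrite conjE /sqn; case: (u i) => a b /=; rewrite mulrN opprK -!expr2.
Qed.

(** The basis is the one chosen inside [Kmu]. The pointwise bound extends off the support, where the
    basis vanishes, and integrating it against [mu] gives [N <= Kmu]. *)
Lemma Kmu_basis (V : set (T -> C)) N :
  (forall f, V f -> L2fun mu f) ->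
  (forall v, V v -> v <> (fun=> 0) ->
     mu [set x | supp mu x /\ v x = 0] = 0%E) ->
  subspace_of_dim V N -> (Kmu mu V N < +oo)%E ->
  exists v : 'I_N -> T -> C, [/\ is_basis V v, forall i, L2fun mu (v i),
    forall u, (\int[mu]_y (sqn (pairing (v ^~ y) u))%:E = (nrm2 u)%:E)%E,
    forall y, nrm2 (v ^~ y) <= fine (Kmu mu V N) &
    N%:R <= fine (Kmu mu V N)].
Proof.
move=> VL VZ dV Koo; have exO := orthonormal_basis_exists VL VZ dV.
pose v : 'I_N -> T -> C := xget (fun _ _ => 0) [set v | orthonormal_basis mu V v].
have ov : orthonormal_basis mu V v.
  by have [w ow] := exO; exact: (xgetI _ ow).
have bv := ov.1.
have Lv i : L2fun mu (v i) by apply: VL; exact: is_basis_mem bv.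
have tight u := orthonormal_basis_tight u VL ov.
have leK y : supp mu y -> ((nrm2 (v ^~ y))%:E <= Kmu mu V N)%E.
  move=> ys; apply: ereal_sup_ubound; exists y => //.
  by congr EFin; apply: eq_bigr => i _; rewrite cmod_sqr.
(* A point of the support rules out that [Kmu] is the supremum of an empty set, minus infinity. *)
have [x0 x0s] : exists x, supp mu x.
  apply/set0P/eqP => s0; have := measure_supp mu; rewrite s0 measure0.
  by move=> /eqP; rewrite eq_sym onee_eq0.
have Kfin : Kmu mu V N \is a fin_num.
  rewrite fin_numE; apply/andP; split.
    apply/eqP => Ke; have := leK _ x0s; rewrite Ke.
    by rewrite leeNy_eq.
  by rewrite lt_eqF.
have K0 : 0 <= fine (Kmu mu V N).
  by rewrite -lee_fin fineK// (le_trans _ (leK _ x0s))// lee_fin nrm2_ge0.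
have leK' y : nrm2 (v ^~ y) <= fine (Kmu mu V N).
  have [ys|ys] := pselect (supp mu y); first by rewrite -lee_fin fineK// leK.
  rewrite /nrm2 big1// => i _; have [-> // _ _ _] := Lv i.
  by rewrite /sqn/= expr0n/= addr0.
exists v; split => //.
have mv i : measurable_fun setT (fun y => (sqn (v i y))%:E).
  exact/measurable_EFinP/measurable_sqn/L2fun_cmeasurable.
have -> : N%:R = fine (\int[mu]_y (nrm2 (v ^~ y))%:E)%E.
  have -> : (\int[mu]_y (nrm2 (v ^~ y))%:E =
             \int[mu]_y (\sum_(i < N) (sqn (v i y))%:E))%E.
    by apply: eq_integral => y _; rewrite /nrm2 sumEFin.
  rewrite ge0_integral_sum//; last by move=> i y _; rewrite lee_fin sqn_ge0.
  have E i : (\int[mu]_y (sqn (v i y))%:E = 1%:E)%E.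
    transitivity (nrm2 (unitv R i))%:E; last first.
      congr EFin; rewrite /nrm2 (bigD1 i)//= /unitv eqxx big1 ?addr0.
        by rewrite /sqn/= expr0n expr1n/= addr0.
      by move=> j ji; rewrite eq_sym (negbTE ji) /sqn/= expr0n/= addr0.
    rewrite -tight; apply: eq_integral => y _; congr (sqn _)%:E.
    rewrite /pairing (bigD1 i)//= /unitv eqxx mulr1 big1 ?addr0// => j ji.
    by rewrite eq_sym (negbTE ji) mulr0.
  under eq_bigr do rewrite E.
  by rewrite sumEFin/= sumr_const card_ord.
have : (\int[mu]_y (nrm2 (v ^~ y))%:E <= (fine (Kmu mu V N))%:E)%E.
  apply: (@le_trans _ _ (\int[mu]_y (cst (fine (Kmu mu V N))%:E y))%E).
    apply: ge0_le_integral => //.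
    - by move=> y _; rewrite lee_fin nrm2_ge0.
    - apply/measurable_EFinP/measurable_nrm2 => i; exact: L2fun_cmeasurable.
    - by move=> y _; rewrite lee_fin.
  by rewrite integral_cst// [X in (_ * X)%E]probability_setT mule1.
move: (\int[mu]_y _)%E => [r|//|//] /=; by rewrite lee_fin.
Qed.

End Christoffel.

(** * Growth of the sample sizes *)

Section growth.
Context (R : realType).

Lemma limn_esup_lt (u : nat -> \bar R) l : (limn_esup u < l)%E ->
  \forall n \near \oo, (u n <= l)%E.
Proof.
rewrite /limn_esup limf_esupE => /ereal_inf_lt[_ [A Aoo <-] Al].
apply: filterS Aoo => n An; apply: le_trans (ltW Al).
by apply: ereal_sup_ubound; exists n.
Qed.

Lemma limn_esup_ge (u : nat -> \bar R) l : (\forall n \near \oo, l <= u n)%E ->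
  (l <= limn_esup u)%E.
Proof.
move=> lu; rewrite /limn_esup limf_esupE.
apply: le_ereal_inf_tmp => _ [A Aoo <-].
have [m _ /(_ m (leqnn m)) [lm Am]] : \forall n \near \oo, (l <= u n)%E /\ A n.
  by near=> n; split; near: n.
by apply: le_trans lm _; apply: ereal_sup_ubound; exists m.
Unshelve. all: by end_near. Qed.

(** The finitely many early terms are absorbed by the sum of their absolute values; this turns
    constants valid for large [n] into constants valid for all [n]. *)
Lemma eventually_bounded (u : nat -> R) C n0 :
  (forall n, (n0 <= n)%N -> u n <= C) ->
  exists2 C', 0 <= C' & forall n, u n <= C'.
Proof.
move=> uC; exists (`|C| + \sum_(i < n0) `|u i|).
  by rewrite addr_ge0// sumr_ge0.
move=> n; have [nn|nn] := leqP n0 n.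
  rewrite (le_trans (uC n nn))// (le_trans (ler_norm _))// lerDl.
  exact: sumr_ge0.
rewrite (bigD1 (Ordinal nn))//= addrCA (le_trans (ler_norm _))// lerDl.
by rewrite addr_ge0// sumr_ge0.
Qed.

Lemma ln2_ge : 2^-1 <= ln 2 :> R.
Proof.
have := @le_ln1Dx R (- 2^-1); rewrite (_ : 1 + - 2^-1 = 2^-1); last by field.
rewrite lnV ?posrE// lerN2; apply; lra.
Qed.

Lemma ln_le_powR (x e : R) : 1 <= x -> 0 < e -> ln x <= x `^ e / e.
Proof.
move=> x1 e0; rewrite ler_pdivlMr// mulrC -ln_powR ltW// ln_sublinear//.
by rewrite powR_gt0// (lt_le_trans _ x1).
Qed.

Section sample_size.
Context (K : nat -> R) (N : nat -> nat) (q : R).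
Hypothesis N_lt : forall n, (N n < N n.+1)%N.
Hypothesis N_ge1 : forall n, (1 <= N n)%N.
Hypothesis NK : forall n, (N n)%:R <= K n.

Lemma N_gt n : (n < N n)%N.
Proof. by elim: n => [|n IH]; [exact: N_ge1|exact: leq_ltn_trans (N_lt n)]. Qed.

Let NR1 n : 1 <= (N n)%:R :> R. Proof. by rewrite ler1n. Qed.
Let K1 n : 1 <= K n. Proof. exact: le_trans (NR1 n) (NK n). Qed.

Let lnN_gt0 n : (0 < n)%N -> 0 < ln (N n)%:R :> R.
Proof. by move=> n0; rewrite ln_gt0// ltr1n (leq_trans _ (N_gt n)). Qed.

(** Since [N <= K], every quotient with positive index is at least 1; index 0 is set aside because
    [ln (N 0)] may be 0. *)
Lemma exponent_ge1 :
  (1%:E <= limn_esup (fun n => (ln (K n) / ln (N n)%:R)%:E))%E.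
Proof.
apply: limn_esup_ge; exists 1%N => // n /= n0.
rewrite lee_fin ler_pdivlMr ?lnN_gt0// mul1r ler_ln ?posrE//.
  exact: lt_le_trans (NR1 n).
exact: lt_le_trans (K1 n).
Qed.

Lemma K_le_powR e :
  limn_esup (fun n => (ln (K n) / ln (N n)%:R)%:E) = q%:E -> 0 < e ->
  exists n0, forall n, (n0 <= n)%N -> K n <= (N n)%:R `^ (q + e).
Proof.
move=> qE e0.
have : (limn_esup (fun n => (ln (K n) / ln (N n)%:R)%:E) < (q + e)%:E)%E.
  by rewrite qE lte_fin ltrDl.
move=> /limn_esup_lt[n0 _ H]; exists (maxn 1 n0) => n.
rewrite geq_max => /andP[n1 nn0]; have := H n nn0.
rewrite lee_fin ler_pdivrMr ?lnN_gt0// -ln_powR ler_ln ?posrE//.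
  by rewrite (lt_le_trans _ (K1 n)).
by rewrite powR_gt0// (lt_le_trans _ (NR1 n)).
Qed.

(** This is [sample_size] with real parameters [q] and [K]; the two agree by conversion. *)
Definition sample_count n : nat :=
  maxn 1 `|Num.ceil (25 * q * K n * ln (N n)%:R)|%N.

Hypothesis q1 : 1 <= q.

Let S_ge0 n : 0 <= 25 * q * K n * ln (N n)%:R.
Proof.
by rewrite !mulr_ge0 ?ln_ge0// ?(le_trans _ (K1 n))// (le_trans _ q1).
Qed.

Let absz_ceil n :
  (`|Num.ceil (25 * q * K n * ln (N n)%:R)|%N)%:R =
  (Num.ceil (25 * q * K n * ln (N n)%:R))%:~R :> R.
Proof.
by rewrite natr_absz ger0_norm// ceil_ge0 (lt_le_trans _ (S_ge0 n))// ltrN10.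
Qed.

Lemma sample_count_ge n : 25 * q * K n * ln (N n)%:R <= (sample_count n)%:R.
Proof.
apply: le_trans (ceil_ge _) _; rewrite -absz_ceil ler_nat /sample_count.
exact: leq_maxr.
Qed.

Lemma sample_count_le n : (sample_count n)%:R <= 2 + 25 * q * K n * ln (N n)%:R.
Proof.
have H := gt_pred_ceil (25 * q * K n * ln (N n)%:R).
apply: (@le_trans _ _ (1 + `|Num.ceil (25 * q * K n * ln (N n)%:R)|%N)%:R).
  by rewrite ler_nat /sample_count geq_max leq_addr leq_addl.
rewrite natrD absz_ceil; move: H; rewrite intrB; lra.
Qed.

(** If [N n] is 1, the minimum of one sample suffices; otherwise [ln 2 >= 1/2] makes [25 * q * ln N]
    at least 1, and [K >= N]. *)
Lemma N_le_sample_count n : (N n <= sample_count n)%N.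
Proof.
have [N1|N2] := leqP (N n) 1%N.
  by apply: leq_trans N1 _; rewrite leq_maxl.
rewrite -(ler_nat R); apply: le_trans (sample_count_ge n).
have l2 : 2^-1 <= ln (N n)%:R :> R.
  by apply: le_trans ln2_ge _; rewrite ler_ln ?posrE ?ler_nat// ltr0n ltnW.
have : 1 * 1 <= q * (25 * ln (N n)%:R) :> R by rewrite ler_pM//; lra.
have := NK n; have := K1 n; nra.
Qed.

(** By 1 - 1/K <= exp (-1/K) and the choice of the sample count, the power is at most N^(-25q). Only
    N^(-3) is kept: times [N] it gives N^(-2), and [n < N n]. *)
Lemma contraction_tail n :
  (N n)%:R * (1 - (K n)^-1) ^+ sample_count n <= ((n.+1)%:R ^+ 2)^-1 :> R.
Proof.
have K0 : 0 < K n by rewrite (lt_le_trans _ (K1 n)).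
have N0 : 0 < (N n)%:R :> R by rewrite (lt_le_trans _ (NR1 n)).
have lN0 : 0 <= ln (N n)%:R :> R by rewrite ln_ge0.
apply: (@le_trans _ _ (((N n)%:R ^+ 2)^-1)); last first.
  by rewrite lef_pV2 ?posrE ?exprn_gt0// ler_pXn2r ?nnegrE// ler_nat N_gt.
have Kinv : (K n)^-1 <= 1 by rewrite invf_le1.
have A : (1 - (K n)^-1) ^+ sample_count n <= expR (- (3 * ln (N n)%:R)).
  apply: (@le_trans _ _ (expR (- (K n)^-1) ^+ sample_count n)).
    by rewrite lerXn2r ?nnegrE ?expR_ge0 ?subr_ge0// expR_ge1Dx.
  rewrite -expRM_natl ler_expR mulrN lerN2 ler_pdivlMr//.
  apply: le_trans (sample_count_ge n).
  have : 1 * ln (N n)%:R <= q * ln (N n)%:R :> R by rewrite ler_wpM2r.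
  nra.
apply: le_trans (ler_wpM2l (ltW N0) A) _.
rewrite expRN -[X in expR X](ln_powR (N n)%:R 3) lnK ?posrE ?powR_gt0//.
rewrite (@powR_mulrn _ _ 3) ?(ltW N0)// le_eqVlt; apply/orP; left; apply/eqP.
by field; rewrite gt_eqF.
Qed.

(** Half of [t] pays for passing from the limsup to a bound on [K], the other half absorbs the
    logarithm. *)
Lemma sample_count_le_powR :
  limn_esup (fun n => (ln (K n) / ln (N n)%:R)%:E) = q%:E ->
  forall t, 0 < t ->
  exists2 C, 0 <= C & forall n, (sample_count n)%:R <= C * (N n)%:R `^ (q + t).
Proof.
move=> qE t t0; have e0 : 0 < t / 2 by rewrite divr_gt0.
have [n0 Kn0] := K_le_powR qE e0.
have P0 n : 0 < (N n)%:R `^ (q + t) by rewrite powR_gt0// (lt_le_trans _ (NR1 n)).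
suff : exists2 C, 0 <= C & forall n, (sample_count n)%:R / (N n)%:R `^ (q + t) <= C.
  by move=> [C C0 H]; exists C => // n; rewrite -ler_pdivrMr.
apply: (@eventually_bounded _ (2 + 25 * q / (t / 2)) n0) => n nn0.
rewrite ler_pdivrMr//; apply: le_trans (sample_count_le n) _.
have H1 : 1 <= (N n)%:R `^ (q + t).
  rewrite -[leLHS](powRr0 (N n)%:R) ler_powR// addr_ge0 ?ltW//.
  by rewrite (lt_le_trans _ q1).
have H2 : K n * ln (N n)%:R <= (N n)%:R `^ (q + t) / (t / 2).
  have -> : q + t = (q + t / 2) + t / 2 by field.
  rewrite powRD; last by apply/implyP => _; rewrite gt_eqF// (lt_le_trans _ (NR1 n)).
  rewrite -mulrA ler_pM ?ln_ge0 ?ln_le_powR ?Kn0//.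
  by rewrite (le_trans _ (K1 n)).
rewrite [leRHS]mulrDl lerD//; first by rewrite ler_peMr.
rewrite -mulrA -[leRHS]mulrA ler_wpM2l ?mulr_ge0 ?(le_trans _ q1)//.
by rewrite [leRHS]mulrC.
Qed.

End sample_size.

(** The sharper bound 2 - 1/(n+1) on the first n+1 terms is inductive, since 1/(x+1)^2 <= 1/x -
    1/(x+1). *)
Lemma sum_inv_sqr_le2 n : \sum_(0 <= k < n) ((k.+1)%:R ^+ 2)^-1 <= 2 :> R.
Proof.
suff H : \sum_(0 <= k < n.+1) ((k.+1)%:R ^+ 2)^-1 <= 2 - (n.+1)%:R^-1 :> R.
  apply: (@le_trans _ _ (\sum_(0 <= k < n.+1) ((k.+1)%:R ^+ 2)^-1)).
    by rewrite big_nat_recr//= lerDl invr_ge0 exprn_ge0.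
  by apply: le_trans H _; rewrite gerBl invr_ge0.
elim: n => [|n IH]; first by rewrite big_nat1 expr1n invr1; lra.
rewrite big_nat_recr//=; apply: le_trans (lerD IH (lexx _)) _.
set x : R := n.+1%:R; have x0 : 0 < x by rewrite /x ltr0n.
have -> : n.+2%:R = x + 1 by rewrite /x -natr1.
suff : ((x + 1) ^+ 2)^-1 <= x^-1 - (x + 1)^-1.
  by move: (x^-1) ((x + 1)^-1) (((x + 1) ^+ 2)^-1) => a b c; lra.
rewrite -subr_ge0.
have -> : x^-1 - (x + 1)^-1 - ((x + 1) ^+ 2)^-1 = x^-1 * ((x + 1) ^+ 2)^-1.
  by field; apply/andP; split; rewrite gt_eqF// addr_gt0.
by rewrite mulr_ge0// invr_ge0 ?exprn_ge0// ?addr_ge0// ltW.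
Qed.

End growth.

(** * Sampling inequalities *)

Section sampled_norm.
Context (R : realType) (d : nat) (mu : probability (Rd R d) R).
Context (d0 : measure_display) (O : measurableType d0) (P : probability O R).
Local Notation C := R[i].
Local Notation T := (Rd R d).
Context (M : nat) (Y : nat -> {mfun O >-> T}) (Yiid : iid_upto P mu M Y).
Context (V : set (T -> C)) (N : nat) (v : 'I_N -> T -> C) (K : R).
Hypothesis bv : is_basis V v.
Hypothesis Lv : forall i, L2fun mu (v i).
Hypothesis tight :
  forall u, (\int[mu]_y (sqn (pairing (v ^~ y) u))%:E = (nrm2 u)%:E)%E.
Hypothesis vK : forall y, nrm2 (v ^~ y) <= K.
Hypothesis K1 : 1 <= K.

(** The mesh inequality for one sample, with an arbitrary bound [c] in place of the maximum. *)
Definition controls (w : O) (b : R) :=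
  forall f c, V f -> 0 <= c -> (forall j, (j < M)%N -> cmod (f (Y j w)) <= c) ->
  forall x, cmod (f x) <= b * c.

Let K0 : 0 < K. Proof. exact: lt_le_trans K1. Qed.

Let V_pairing f : V f -> exists u, forall x, f x = pairing (v ^~ x) u.
Proof.
move: bv => [-> _] [u ->]; exists u => x.
by apply: eq_bigr => i _; rewrite mulrC.
Qed.

Let cmod_le (z : C) b : 0 <= b -> sqn z <= b ^+ 2 -> cmod z <= b.
Proof. by move=> b0 zb; rewrite -(@ler_pXn2r _ 2)// ?nnegrE ?cmod_ge0// cmod_sqr. Qed.

Let sqn_le (z : C) b : cmod z <= b -> sqn z <= b ^+ 2.
Proof.
move=> zb; rewrite -cmod_sqr ler_pXn2r// ?nnegrE ?cmod_ge0//.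
by rewrite (le_trans _ zb)// cmod_ge0.
Qed.

Let cv i : cmeasurable (v i). Proof. exact: L2fun_cmeasurable (Lv i). Qed.

(** The bad event [F] is that the squared Frobenius norm is at least 1/4; Markov's inequality bounds
    it, whence the factor 4. Off [F], stability with step 1/K gives |f(x)|^2 <= K |u|^2 <= 4 M
    c^2. *)
Lemma controls_whp : exists F, [/\ measurable F,
  (P F <= (4 * (N%:R * (1 - K^-1) ^+ M))%:E)%E &
  forall w, ~ F w -> controls w (2 * Num.sqrt M%:R)].
Proof.
pose Q w (i : 'I_N) := nrm2 (kaczmarz K^-1 (fun j => v ^~ (Y j w)) M (unitv R i)).
have av y : K^-1 * nrm2 (v ^~ y) <= 1 by rewrite mulrC ler_pdivrMr// mul1r.
have a0 : 0 <= K^-1 by rewrite invr_ge0 ltW.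
have a1 : K^-1 <= 1 by rewrite invf_le1.
have mQ i : measurable_fun setT (fun w => Q w i).
  apply: measurable_nrm2 => k.
  have [r s] := @cmeasurable_kaczmarz _ _ _ _ _ Y _ (fun y => v ^~ y) K^-1 cv
    (unitv R i) M k.
  by split; apply: (@measurable_fun_past_id _ _ _ _ Y M); [exact: r|exact: s].
have mS : measurable_fun setT (fun w => \sum_i Q w i).
  exact: measurable_sum.
have Q0 w i : 0 <= Q w i by exact: nrm2_ge0.
exists [set w | 4^-1 <= \sum_i Q w i]; split.
- rewrite (_ : [set _ | _] = (fun w => \sum_i Q w i) @^-1` `[4^-1, +oo[).
    by rewrite -[_ @^-1` _]setTI; exact: mS.
  by apply/seteqP; split=> w /=; rewrite in_itv/= andbT.
- set F := [set _ | _].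
  have mF : measurable F.
    rewrite (_ : F = (fun w => \sum_i Q w i) @^-1` `[4^-1, +oo[).
      by rewrite -[_ @^-1` _]setTI; exact: mS.
    by apply/seteqP; split=> w /=; rewrite in_itv/= andbT.
  have -> : P F = (\int[P]_w (\1_F w)%:E)%E by rewrite integral_indic// setIT.
  apply: (@le_trans _ _ (\int[P]_w (4%:E * \sum_i (Q w i)%:E))%E).
    apply: ge0_le_integral => //.
    - by apply/measurable_EFinP; exact: measurable_indic.
    - under eq_fun do rewrite sumEFin.
      by apply: measurable_funeM; exact/measurable_EFinP.
    - move=> w _; rewrite sumEFin -EFinM lee_fin indicE.
      have [|] := boolP (w \in F); last by rewrite mulr_ge0// sumr_ge0.
      by rewrite inE /F/= => H; lra.
  rewrite ge0_integralZl//; last 2 first.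
  - under eq_fun do rewrite sumEFin.
    exact/measurable_EFinP.
  - by move=> w _; apply: sume_ge0 => i _; rewrite lee_fin.
  rewrite EFinM lee_wpmul2l//.
  rewrite ge0_integral_sum//; last 2 first.
  - by move=> i; exact/measurable_EFinP.
  - by move=> i w _; rewrite lee_fin.
  apply: (@le_trans _ _ (\sum_(i < N) ((1 - K^-1) ^+ M * nrm2 (unitv R i))%:E)%E).
    apply: lee_sum => i _.
    exact: (integral_nrm2_kaczmarz Yiid (v := fun y => v ^~ y) cv a0 av tight).
  rewrite sumEFin lee_fin -mulr_sumr mulrC ler_wpM2r//.
    by rewrite exprn_ge0// subr_ge0.
  rewrite (eq_bigr (fun=> 1)) ?sumr_const ?card_ord// => i _.
  rewrite /nrm2 (bigD1 i)//= /unitv eqxx big1 ?addr0.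
    by rewrite /sqn/= expr0n expr1n/= addr0.
  by move=> j ji; rewrite eq_sym (negbTE ji) /sqn/= expr0n/= addr0.
- move=> w /negP; rewrite -ltNge => small f c /V_pairing[u fE] c0 fc x.
  have := @kaczmarz_stability _ _ K^-1 (fun j => v ^~ (Y j w)) M u a0
    (fun j _ => av _) small.
  move=> stab; apply: cmod_le; first by rewrite !mulr_ge0.
  rewrite fE; apply: le_trans (sqn_pairing _ _) _.
  apply: (@le_trans _ _ (K * (4 * K^-1 * \sum_(j < M) sqn (pairing (v ^~ (Y j w)) u)))).
    by apply: ler_pM => //; exact: nrm2_ge0.
  have -> : K * (4 * K^-1 * \sum_(j < M) sqn (pairing (v ^~ (Y j w)) u)) =
            4 * \sum_(j < M) sqn (pairing (v ^~ (Y j w)) u).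
    by field; rewrite gt_eqF.
  rewrite !exprMn sqr_sqrtr// -mulrA (_ : 2 ^+ 2 = 4); last by ring.
  rewrite ler_wpM2l//.
  apply: (@le_trans _ _ (\sum_(j < M) c ^+ 2)).
    by apply: ler_sum => j _; rewrite -fE; apply: sqn_le; exact: fc.
  by rewrite sumr_const card_ord mulr_natl.
Qed.

Hypothesis VZ : forall f, V f -> f <> (fun=> 0) ->
     mu [set x | supp mu x /\ f x = 0] = 0%E.

(** Almost surely the first [N] samples give an invertible matrix, and its inverse recovers the
    coefficients from the sampled values. The resulting constant is finite but depends on [w]. *)
Lemma controls_as : (N <= M)%N -> {ae P, forall w, exists b, controls w b}.
Proof.
move=> NM.
(* The basis is padded by zero, because [sample_mx] takes a family indexed by [nat]. *)
pose v' (k : nat) : T -> C := if insub k is Some i then v i else fun=> 0.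
have v'E (i : 'I_N) : v' i = v i by rewrite /v' valK.
have cv' k : cmeasurable (v' k).
  by rewrite /v'; case: insub => [i|]; [exact: cv|exact: cmeasurable_cst].
have Z : P [set w | \det (sample_mx Y v' N w) = 0] = 0%E.
  apply: (sample_mx_singular_negligible Yiid) => // k c kN ck.
  pose c' (j : nat) : C := if insub j is Some j' then c j' else 0.
  pose f x := \sum_(i < N) c' i * v i x.
  have fE y : \sum_(j < k.+1) c j * v' j y = f y.
    transitivity (\sum_(j < k.+1) c' j * v' j y).
      by apply: eq_bigr => j _; rewrite /c' valK.
    rewrite (big_ord_widen N (fun j => c' j * v' j y))// big_mkcond.
    apply: eq_bigr => i _; rewrite v'E; case: ifPn => // ik.
    by rewrite /c' insubN// mul0r.
  have Vf : V f by exact: is_basis_lincomb bv.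
  have f0 : f <> (fun=> 0).
    move=> f0; have [_ /(_ (fun i : 'I_N => c' i)) c'0] := bv.
    have := c'0 (fun x => congr1 (fun g : T -> C => g x) f0) (Ordinal kN).
    rewrite /c'; case: insubP => [j _ jk|/=]; last by rewrite ltnSn.
    by rewrite (_ : j = ord_max); [exact/eqP|exact/val_inj].
  have mf : measurable [set x | f x = 0].
    apply: measurable_zero_set; apply: cmeasurable_sum => i.
    by apply: cmeasurableM => //; exact: cmeasurable_cst.
  rewrite (_ : [set y | _] = [set x | f x = 0]); last first.
    by apply/seteqP; split=> y /=; rewrite fE.
  apply: measure_negligible => //.
  have N1 : mu.-negligible [set x | supp mu x /\ f x = 0].
    apply/negligibleP; last exact: VZ.
    by apply: measurableI => //; exact: measurable_supp.
  have N2 : mu.-negligible (~` supp mu).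
    apply/negligibleP; last exact: measure_setC_supp.
    by apply: measurableC; exact: measurable_supp.
  apply: negligibleS (negligibleU N1 N2) => x fx.
  by have [xs|xs] := pselect (supp mu x); [left|right].
exists [set w | \det (sample_mx Y v' N w) = 0]; split => //.
  apply: (@past_measurable _ _ _ _ Y N); apply: measurable_zero_set.
  exact: (cmeasurable_det_past Y cv' val (fun i : 'I_N => ltn_ord i)).
move=> w /=; apply: contra_notP => /eqP dw.
set A := sample_mx Y v' N w in dw.
have uA : A \in unitmx by rewrite unitmxE unitfE.
(* Cauchy-Schwarz is used twice: at the point [x], giving [K], and for each coefficient, giving a
   row of the inverse and [N] values bounded by [c]. *)
pose B := K * ((\sum_j nrm2 (invmx A j)) * N%:R).
have B0 : 0 <= B.
  by rewrite !mulr_ge0 ?(ltW K0)// sumr_ge0// => j _; exact: nrm2_ge0.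
exists (Num.sqrt B) => f c /V_pairing[u fE] c0 fc x.
have uE j : u j = pairing (invmx A j) (fun i => f (Y i w)).
  have H : A *m (\col_i u i) = \col_i f (Y i w).
    apply/colP => i; rewrite !mxE fE; apply: eq_bigr => l _.
    by rewrite !mxE v'E.
  have := mulKmx uA (\col_i u i); rewrite H => /colP/(_ j); rewrite !mxE => <-.
  by apply: eq_bigr => i _; rewrite mxE.
apply: cmod_le; first by rewrite mulr_ge0// sqrtr_ge0.
rewrite fE exprMn sqr_sqrtr//; apply: le_trans (sqn_pairing _ _) _.
rewrite /B -!mulrA ler_pM ?nrm2_ge0// mulr_suml; apply: ler_sum => j _.
rewrite uE; apply: le_trans (sqn_pairing _ _) _.
rewrite ler_wpM2l ?nrm2_ge0//.
apply: (@le_trans _ _ (\sum_(i < N) c ^+ 2)).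
  apply: ler_sum => i _; apply: sqn_le; apply: fc.
  exact: leq_trans (ltn_ord i) NM.
by rewrite sumr_const card_ord mulr_natl.
Qed.

End sampled_norm.

(** * From the samples to the almost sure mesh *)

Lemma iid_upto_of_iid (R : realType) (d0 d1 : measure_display)
  (O : measurableType d0) (T : measurableType d1)
  (P : probability O R) (mu : probability T R) (M : nat)
  (X : 'I_M -> {RV P >-> T}) : (0 < M)%N -> iid mu X ->
  exists2 Y : nat -> {mfun O >-> T}, forall i : 'I_M, Y i = X i
    & iid_upto P mu M Y.
Proof.
move=> M0 [indepX lawX].
(* Indices from [M] on repeat sample 0, which exists because [M] is positive. *)
pose Y k : {mfun O >-> T} := X (insubd (Ordinal M0) k).
have YE (i : 'I_M) : Y i = X i by rewrite /Y valKd.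
exists Y => // B mB.
pose J : {fset 'I_M} := [fset i | i in 'I_M]%fset.
have JE i : i \in J by apply/imfsetP; exists i.
have -> : \bigcap_(i in `I_M) (Y i @^-1` B i) =
    \bigcap_(i in [set` J]) (X i @^-1` B i).
  apply/seteqP; split=> w H i /=.
    by move=> _; have := H i (ltn_ord i); rewrite /= YE.
  by move=> iM; have := H (Ordinal iM) (JE _); rewrite /= -YE.
rewrite (indepX J (fun i => B i))//.
transitivity (\prod_(i <- enum 'I_M) P (X i @^-1` B i))%E.
  apply: perm_big; apply: uniq_perm; rewrite ?enum_uniq ?fset_uniq// => i.
  by rewrite mem_enum JE.
rewrite big_enum/=; apply: eq_bigr => i _.
exact: (lawX i (B i) (mB i)).
Qed.

Theorem corollary4p2 (R : realType) (d : nat) (mu : probability (Rd R d) R)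
  (V : nat -> set (Rd R d -> R[i])) (N : nat -> nat)
  (V_L2 : forall n f, V n f -> L2fun mu f)
  (V_hier : hierarchical V N)
  (K_fin : forall n, (Kmu mu (V n) (N n) < +oo)%E)
  (q_fin : (qstar mu V N < +oo)%E)
  (V_ZC : muZC mu V)
  (dO : measure_display) (Omega : measurableType dO) (P : probability Omega R)
  (X : forall n, 'I_(sample_size mu V N n) -> {RV P >-> Rd R d})
  (X_iid : forall n, iid mu (X n)) :
  {ae P, forall w : Omega, forall tau : R, 0 < tau ->
    is_WAM (supp mu) V N (fun n => sample_set (X n) w)
      (fine (qstar mu V N) + tau) (fine (qstar mu V N) / 2 + tau)}.
Proof.
have [V_dim _ N_lt N_ge1] := V_hier.
pose K n := fine (Kmu mu (V n) (N n)).
set q := fine (qstar mu V N).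
have basis n := Kmu_basis (V_L2 n) (V_ZC n) (V_dim n) (K_fin n).
have NK n : (N n)%:R <= K n by have [v []] := basis n.
have NR1 n : 1 <= (N n)%:R :> R by rewrite ler1n.
have K1 n : 1 <= K n := le_trans (NR1 n) (NK n).
(* With [q_fin] this makes [qstar] a finite number, so that [fine] loses nothing. *)
have qge1 : (1%:E <= qstar mu V N)%E := exponent_ge1 N_lt N_ge1 NK.
have qE : qstar mu V N = q%:E.
  by rewrite /q fineK// fin_numE gt_eqF ?lt_eqF// (lt_le_trans _ qge1)// ltNyr.
have q1 : 1 <= q by rewrite -lee_fin -qE.
pose M := sample_size mu V N.
have ME n : M n = sample_count K N q n by [].
have M0 n : (0 < M n)%N by rewrite leq_max.
pose good n w b := forall f c, V n f -> 0 <= c ->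
  (forall m, cmod (f (X n m w)) <= c) -> forall x, cmod (f x) <= b * c.
have whp n : exists F, [/\ measurable F,
    (P F <= (4 * ((n.+1)%:R ^+ 2)^-1)%:E)%E &
    forall w, ~ F w -> good n w (2 * Num.sqrt (M n)%:R)].
  have [Y YX Yiid] := iid_upto_of_iid (M0 n) (X_iid n).
  have [v [bv Lv tight vK _]] := basis n.
  have [F [mF PF goodF]] := controls_whp Yiid bv Lv tight vK (K1 n).
  exists F; split => //.
    apply: le_trans PF _; rewrite lee_fin ler_wpM2l//.
    exact: (contraction_tail N_lt N_ge1 NK q1).
  move=> w /goodF H f c Vf c0 fc; apply: H => // j jM.
  by have := fc (Ordinal jM); rewrite -YX.
have as_good n : {ae P, forall w, exists b, good n w b}.
  have [Y YX Yiid] := iid_upto_of_iid (M0 n) (X_iid n).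
  have [v [bv Lv tight vK _]] := basis n.
  have NM : (N n <= M n)%N := N_le_sample_count N_ge1 NK q1 n.
  have := controls_as Yiid bv Lv vK (K1 n) (V_ZC n) NM.
  apply: filterS => w [b H]; exists b => f c Vf c0 fc; apply: H => // j jM.
  by have := fc (Ordinal jM); rewrite -YX.
have as_supp n : {ae P, forall w, forall m, supp mu (X n m w)}.
  (* The sample index is replaced by its value in [nat], to apply countable intersection; values
     from [M n] on are vacuous. *)
  have H (j : nat) :
      {ae P, forall w, forall m, nat_of_ord m = j -> supp mu (X n m w)}.
    have [jM|jM] := ltnP j (M n); last first.
      by apply: aeW => w m mj; have := ltn_ord m; rewrite mj ltnNge jM.
    have mC : measurable (~` supp mu) by apply: measurableC; exact: measurable_supp.
    exists (X n (Ordinal jM) @^-1` (~` supp mu)); split.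
    - by rewrite -[_ @^-1` _]setTI; exact: (measurable_funPT (X n (Ordinal jM))).
    - have [_ law] := X_iid n; apply: etrans (law (Ordinal jM) _ mC) _.
      exact: measure_setC_supp.
    - move=> w /= Hw s; apply: Hw => m mj.
      by rewrite (_ : m = Ordinal jM)//; exact/val_inj.
  have := ae_foralln H; apply: filterS => w Hw m; exact: (Hw m).
have [F HF] := choice whp.
have as_eventually : {ae P, forall w, exists n0, forall n, (n0 <= n)%N -> ~ F n w}.
  (* Borel-Cantelli: the probabilities of the bad events sum to at most 4 * 2 = 8. *)
  exists (lim_sup_set F); split.
  - apply: bigcapT_measurable => n; apply: bigcup_measurable => k _.
    by have [] := HF k.
  - apply: lim_sup_set_cvg0; first by move=> k; have [] := HF k.
    apply: (@le_lt_trans _ _ 8%:E); last by rewrite ltry.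
    apply: lime_le; first exact: is_cvg_nneseries.
    near=> n.
    apply: (@le_trans _ _ (\sum_(0 <= k < n) (4 * ((k.+1)%:R ^+ 2)^-1)%:E)%E).
      by apply: lee_sum => k _; have [] := HF k.
    rewrite sumEFin lee_fin -mulr_sumr (_ : 8 = 4 * 2); last by ring.
    by rewrite ler_wpM2l// sum_inv_sqr_le2.
  - move=> w /= H n _; apply: contrapT => Hn; apply: H; exists n => k nk Fk.
    by apply: Hn; exists k.
have all_good := ae_foralln as_good.
have all_supp := ae_foralln as_supp.
(* None of the three almost sure events involves [tau], so one null set serves every [tau]. *)
apply: filterS3 all_good all_supp as_eventually => w wgood wsupp [n0 wn0] tau tau0.
split.
  by move=> n x /imfsetP[m _ ->]; exact: wsupp.
have [ka ka0 kaP] := sample_count_le_powR N_lt N_ge1 NK q1 qE tau0.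
have P0 n (e : R) : 0 < (N n)%:R `^ e by rewrite powR_gt0// (lt_le_trans _ (NR1 n)).
have [b bP] := choice wgood.
(* The explicit constant is used once the bad events have stopped, the random one at the finitely
   many earlier indices. *)
pose b' n := if (n0 <= n)%N then 2 * Num.sqrt (M n)%:R else b n.
have b'P n : good n w (b' n).
  rewrite /b'; case: ifP => [/wn0 Fw|_]; last exact: bP.
  by have [_ _] := HF n; apply.
have [kb kb0 kbP] : exists2 kb, 0 <= kb &
    forall n, b' n / (N n)%:R `^ (q / 2 + tau) <= kb.
  (* From [M <= ka * N^(q + tau)], the square root of [M] is at most that of [ka] times N^((q +
     tau)/2), and (q + tau)/2 <= q/2 + tau. *)
  apply: (@eventually_bounded _ _ (2 * Num.sqrt ka) n0) => n nn0.
  rewrite ler_pdivrMr// /b' nn0 -mulrA ler_wpM2l//.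
  apply: (@le_trans _ _ (Num.sqrt (ka * (N n)%:R `^ (q + tau)))).
    by rewrite ler_wsqrtr// -kaP.
  rewrite sqrtrM// ler_wpM2l ?sqrtr_ge0// -powR12_sqrt ?powR_ge0//.
  by rewrite -powRrM ler_powR//; lra.
exists ka, kb => n; split; last first.
  (* Samples may coincide, so the mesh has at most [M n] points. *)
  apply: le_trans (kaP n); rewrite ler_nat -ME.
  apply: leq_trans (leq_imfset_card _ _ _) _.
  by rewrite -cardE card_ord.
move=> f Vf; set c := \big[Num.max/0]_(x <- _) _.
apply: ge_ereal_sup => _ [x _ <-]; rewrite lee_fin.
have c0 : 0 <= c by exact: bigmax_ge_id.
apply: (@le_trans _ _ (b' n * c)).
  apply: b'P => // m; rewrite /c.
  apply: (@le_bigmax_seq _ _ _ _ _ (X n m w) xpredT (fun x => cmod (f x))) => //.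
  by apply/imfsetP; exists m.
by rewrite ler_wpM2r// -ler_pdivrMr.
Unshelve. all: by end_near.
Qed.
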